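(* Let $l$ be a fixed positive integer and $c$ a rational constant. Suppose there is a polynomial-time algorithm that, for every chordal graph $G$ with edge weights $w:E(G)\to\mathbb{Q}_+$, outputs a maximal distance-$2l$ matching of weight at most $c\ln|V(G)|$ times the minimum weight of a maximal distance-$2l$ matching of $G$. Then for every integer $d>1$ there is a polynomial-time $c(d+1)\ln|X|$-approximation algorithm for the Set Cover problem restricted to instances $(X,S)$ with $|S|\le|X|^d$.
   Context: The distance between two edges $e_1,e_2$ of $G$ is $\min_{u\in e_1,v\in e_2}\mathrm{dist}_G(u,v)$. A distance-$k$ matching is a set of edges with pairwise distances between distinct edges at least $k$; it is maximal if not contained in another distance-$k$ matching. The weight of a matching is the sum of its edge weights; $\mathbb{Q}_+$ denotes the positive rationals. Set Cover: given a finite universe $X$ and a collection $S$ of subsets of $X$, find a minimum number of sets from $S$ whose union is $X$; a $\beta$-approximation algorithm outputs a cover of size at most $\beta$ times the optimum.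
   Formalization: Set Cover instances are restricted to |X| ≥ 2: for |X| = 1 the ratio c(d+1)ln|X| is 0 while the optimum is 1, so no algorithm can achieve it, and for |X| = 0 the logarithm is undefined. *)

(* Defs.v *)
From HB Require Import structures.
From mathcomp Require Import all_boot all_order all_algebra.
From mathcomp Require Import classical_sets reals ereal exp.
Set Implicit Arguments.
Unset Strict Implicit.
Unset Printing Implicit Defensive.
Import Order.TTheory GRing.Theory Num.Theory.
Local Open Scope ring_scope.

(* Computation model: the WHILE language on binary trees (N. D. Jones,
   "Computability and Complexity from a Programming Perspective"), with tree
   variables, cons/hd/tl and while loops. *)

Inductive tree : Type := Leaf | Node of tree & tree.

Fixpoint tree_size (t : tree) : nat :=
  if t is Node a b then (tree_size a + tree_size b).+1 else 1%N.

Inductive expr : Type :=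
  | EVar of nat
  | ENil
  | ECons of expr & expr
  | EHd of expr
  | ETl of expr.

Inductive cmd : Type :=
  | Assign of nat & expr
  | Seq of cmd & cmd
  | While of expr & cmd.

Definition store := nat -> tree.

Definition update (s : store) (x : nat) (v : tree) : store :=
  fun y => if y == x then v else s y.

Fixpoint eval (s : store) (E : expr) : tree :=
  match E with
  | EVar x => s x
  | ENil => Leaf
  | ECons E1 E2 => Node (eval s E1) (eval s E2)
  | EHd E1 => if eval s E1 is Node a _ then a else Leaf
  | ETl E1 => if eval s E1 is Node _ b then b else Leaf
  end.

(* [exec C s t s'] : started in store s, the command C halts in store s' at
   total cost t.  An assignment is charged the full size of the tree it stores
   (not a unit cost), so at every moment the size of the store is at most the
   size of the input plus the cost incurred, up to a constant depending on the
   program.  Hence the cost is polynomially related to Turing machine time. *)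
Inductive exec : cmd -> store -> nat -> store -> Prop :=
  | ExecAssign s x E :
      exec (Assign x E) s (tree_size (eval s E)).+1 (update s x (eval s E))
  | ExecSeq C1 C2 s s1 s2 t1 t2 :
      exec C1 s t1 s1 -> exec C2 s1 t2 s2 ->
      exec (Seq C1 C2) s (t1 + t2)%N s2
  | ExecWhileDone E C s :
      eval s E = Leaf -> exec (While E C) s 1%N s
  | ExecWhileLoop E C s s1 s2 t1 t2 :
      eval s E <> Leaf -> exec C s t1 s1 -> exec (While E C) s1 t2 s2 ->
      exec (While E C) s (t1 + t2).+1 s2.

(* Input and output are in variable 0; the other variables start as Leaf. *)
Definition computes (C : cmd) (x : tree) (t : nat) (y : tree) : Prop :=
  exists s, exec C (update (fun=> Leaf) 0 x) t s /\ s 0%N = y.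

(* A single deterministic program that, on (the code of) every instance i
   satisfying the promise D, outputs the code of a solution o with spec i o,
   at a cost polynomial in the size of the code of i. *)
Definition poly_time_algorithm (I : Type) (O : I -> Type) (D : I -> Prop)
    (encI : I -> tree) (encO : forall i, O i -> tree)
    (spec : forall i, O i -> Prop) : Prop :=
  exists (C : cmd) (p : {poly nat}), forall i : I, D i ->
  exists (o : O i) (t : nat),
    [/\ computes C (encI i) t (encO i o),
        (t <= p.[tree_size (encI i)])%N & spec i o].

Definition enc_bool (b : bool) : tree := if b then Node Leaf Leaf else Leaf.

Definition enc_seq (s : seq tree) : tree := foldr Node Leaf s.

(* Binary, least significant bit first; up_log 2 n.+1 is the bit length of n. *)
Definition enc_nat (n : nat) : tree :=
  enc_seq [seq enc_bool (odd (n %/ 2 ^ i)) | i <- iota 0 (up_log 2 n.+1)].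

(* Only applied to q > 0. *)
Definition enc_posrat (q : rat) : tree :=
  Node (enc_nat `|numq q|%N) (enc_nat `|denq q|%N).

(* f is an objective to be minimized over the feasible solutions P; y is
   feasible with value at most beta times the minimum f x. *)
Definition approx_min (R : realType) (U : Type) (P : U -> Prop) (f : U -> R)
    (beta : R) (y : U) : Prop :=
  P y /\
  forall x, P x -> (forall z, P z -> f x <= f z) -> f y <= beta * f x.

Definition chordal (T : finType) (e : rel T) : Prop :=
  forall c : seq T, ucycle e c -> (3 < size c)%N ->
  exists x y, [/\ x \in c, y \in c, e x y, y != next c x & x != next c y].

Definition edges (T : finType) (e : rel T) : {set {set T}} :=
  [set [set x; y] | x in T, y in T & e x y].

(* +oo when x and y lie in different components. *)
Definition gdist (R : realType) (T : finType) (e : rel T) (x y : T) : \bar R :=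
  ereal_inf [set ((size p)%:R)%:E | p in
               [set p : seq T | path e x p /\ last x p = y]]%classic.

Definition edge_dist (R : realType) (T : finType) (e : rel T)
    (A B : {set T}) : \bar R :=
  \big[Order.min/+oo%E]_(u in A) \big[Order.min/+oo%E]_(v in B) gdist R e u v.

Definition dist_matching (R : realType) (T : finType) (e : rel T) (k : nat)
    (M : {set {set T}}) : Prop :=
  M \subset edges e /\
  forall A B, A \in M -> B \in M -> A != B ->
    ((k%:R)%:E <= edge_dist R e A B)%E.

Definition maximal_dist_matching (R : realType) (T : finType) (e : rel T)
    (k : nat) (M : {set {set T}}) : Prop :=
  dist_matching R e k M /\
  forall M', dist_matching R e k M' -> M \subset M' -> M' = M.

Record wgraph : Type := WGraph {
  nverts : nat;
  adj : rel 'I_nverts;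
  adj_sym : symmetric adj;
  adj_irr : irreflexive adj;
  wt : {set 'I_nverts} -> rat;
  wt_gt0 : forall A, A \in edges adj -> 0 < wt A
}.

Definition weight (G : wgraph) (M : {set {set 'I_(nverts G)}}) : rat :=
  \sum_(A in M) wt A.

(* Weighted adjacency matrix; a weight is encoded as a Node, a non-edge as
   Leaf. *)
Definition enc_wgraph (G : wgraph) : tree :=
  enc_seq [seq enc_seq
    [seq if adj i j then enc_posrat (wt [set i; j]) else Leaf
       | j <- enum 'I_(nverts G)] | i <- enum 'I_(nverts G)].

Definition enc_edge_set (G : wgraph) (M : {set {set 'I_(nverts G)}}) : tree :=
  enc_seq [seq enc_seq
    [seq enc_bool ([set i; j] \in M) | j <- enum 'I_(nverts G)]
       | i <- enum 'I_(nverts G)].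

(* The collection is given as a duplicate-free list; an instance is feasible,
   i.e. the union of the whole collection is the universe. *)
Record set_cover_instance : Type := SetCoverInstance {
  univ : nat;
  sets : seq {set 'I_univ};
  sets_uniq : uniq sets;
  sets_feasible : \bigcup_(A <- sets) A = [set: 'I_univ]
}.

Definition is_set_cover (I : set_cover_instance)
    (C : {set {set 'I_(univ I)}}) : Prop :=
  {subset C <= sets I} /\ finset.cover C = [set: 'I_(univ I)].

(* Incidence matrix, one row per set. *)
Definition enc_set_cover_instance (I : set_cover_instance) : tree :=
  enc_seq [seq enc_seq [seq enc_bool (x \in A) | x <- enum 'I_(univ I)]
             | A : {set _} <- sets I].

Definition enc_subcollection (I : set_cover_instance)
    (C : {set {set 'I_(univ I)}}) : tree :=
  enc_seq [seq enc_bool (A \in C) | A <- sets I].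

(* Main.v *)
(* Write n = |X| and m = |S|.  The graph has n + m branches, one per element and
   one per set; a branch is a path whose base vertex lies in a split graph, in
   which the element bases form a clique and the base of a set is joined to the
   bases of its elements.  The branch of a set k ends with two consecutive cheap
   edges at depths l-1, l, l+1: e_k, of weight 2^(2N), and f_k, of weight 1.  The
   branch of an element x ends with an edge e_x at depths l-1, l.  All edges
   other than the e_k and f_k are so heavy that an approximate solution avoids
   them.  At distance 2l the edges e_k and f_k conflict, edges of different set
   branches do not, and e_x conflicts with e_k exactly when x belongs to the set
   k.  So a maximal matching made of cheap edges picks one of e_k, f_k for each k,
   and its maximality at the edges e_x says that the sets with e_k picked cover X;
   conversely every cover gives a maximal matching.  With N = (n + m)(l + 2)
   vertices, n <= 4(l + 2) leaves finitely many instances, solved by a table, and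
   otherwise 2N <= n^(d+1), where the gap ln 2 between ln N and (d + 1) ln n
   absorbs the total weight of the f_k. *)
From Pilot Require Import Defs.
From mathcomp Require Import all_boot all_order all_algebra.
From mathcomp Require Import classical_sets reals ereal exp.
From mathcomp Require Import boolp zify ring lra.
From Stdlib Require List.
Import Pilot.Defs.
Set Implicit Arguments.
Unset Strict Implicit.
Unset Printing Implicit Defensive.
Import Order.TTheory GRing.Theory Num.Theory.

Local Open Scope nat_scope.

(** * Polynomial-time WHILE programs *)

Lemma hornerD_nat (p q : {poly nat}) n :
  ((p + q)%R).[n]%R = (p.[n]%R + q.[n]%R)%N.
Proof. exact: hornerD. Qed.

Lemma hornerM_nat (p q : {poly nat}) n :
  ((p * q)%R).[n]%R = (p.[n]%R * q.[n]%R)%N.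
Proof. exact: hornerM. Qed.

Lemma hornerC_nat (k n : nat) : (k%:P).[n]%R = k.
Proof. exact: hornerC. Qed.

Lemma hornerX_nat (n : nat) : ('X).[n]%R = n.
Proof. exact: hornerX. Qed.

Lemma horner_comp_nat (p q : {poly nat}) (n : nat) :
  ((p \Po q)%R).[n]%R = p.[q.[n]]%R.
Proof. exact: horner_comp. Qed.

Definition horner_natE :=
  (hornerD_nat, hornerM_nat, hornerC_nat, hornerX_nat, horner_comp_nat).

Lemma leq_horner (p : {poly nat}) m n : m <= n -> p.[m]%R <= p.[n]%R.
Proof.
move=> le_mn; elim/poly_ind: p => [|p a IH]; first by rewrite !horner0.
by rewrite !horner_natE leq_add2r leq_mul.
Qed.

Definition st0 (x : tree) : store := update (fun=> Leaf) 0 x.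

Lemma updateC s j k a b : j != k ->
  update (update s j a) k b = update (update s k b) j a.
Proof.
move=> jk; apply/funext => i; rewrite /update.
by case: eqP => // ->; rewrite eq_sym (negbTE jk).
Qed.

Lemma update_update s k a b : update (update s k a) k b = update s k b.
Proof. by apply/funext => i; rewrite /update; case: eqP. Qed.

Lemma update_eq s k a : update s k a k = a.
Proof. by rewrite /update eqxx. Qed.

Lemma update_neq s j k a : j != k -> update s j a k = s k.
Proof. by rewrite /update eq_sym => /negbTE->. Qed.

(* Variables with index at least [vbound C] do not occur in [C]. *)
Fixpoint ebound (E : expr) : nat :=
  match E with
  | EVar x => x.+1
  | ENil => 0
  | ECons E1 E2 => maxn (ebound E1) (ebound E2)
  | EHd E1 => ebound E1
  | ETl E1 => ebound E1
  end.

Fixpoint vbound (C : cmd) : nat :=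
  match C with
  | Assign x E => maxn x.+1 (ebound E)
  | Seq C1 C2 => maxn (vbound C1) (vbound C2)
  | While E C1 => maxn (ebound E) (vbound C1)
  end.

Lemma eval_frame E s k v : ebound E <= k -> eval (update s k v) E = eval s E.
Proof.
elim: E => //= [x xk|E1 IH1 E2 IH2|E1 IH|E1 IH]; last 2 first.
- by move/IH->.
- by move/IH->.
- by rewrite update_neq // gtn_eqF.
by rewrite geq_max => /andP[/IH1-> /IH2->].
Qed.

(** Registers beyond [vbound C] keep whatever they hold, so they can store data of a surrounding
    program while [C] runs. *)
Lemma exec_frame C s t s' k v : exec C s t s' -> vbound C <= k ->
  exec C (update s k v) t (update s' k v).
Proof.
elim=> {C s t s'} [s x E|C1 C2 s s1 s2 t1 t2 _ IH1 _ IH2|E C s e0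
  |E C s s1 s2 t1 t2 e1 _ IH1 _ IH2] /=; rewrite geq_max => /andP[h1 h2].
- rewrite updateC; last by rewrite ltn_eqF.
  by rewrite -(eval_frame s v h2); apply: ExecAssign.
- by apply: ExecSeq; [apply: IH1|apply: IH2].
- by apply: ExecWhileDone; rewrite eval_frame.
- apply: ExecWhileLoop; first by rewrite eval_frame.
  + exact: IH1.
  + by apply: IH2 => /=; rewrite geq_max h1.
Qed.

Lemma exec_unchanged C s t s' k : exec C s t s' -> vbound C <= k -> s' k = s k.
Proof.
elim=> {C s t s'} [s x E|C1 C2 s s1 s2 t1 t2 _ IH1 _ IH2|E C s e0
  |E C s s1 s2 t1 t2 e1 _ IH1 _ IH2] //=; rewrite geq_max => /andP[h1 h2].
- by rewrite update_neq // ltn_eqF.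
- by rewrite IH2 ?IH1.
- by rewrite IH2 /= ?geq_max ?h1 // IH1.
Qed.

(** An assignment is charged the size of the value it stores, so a register grows by at most the
    time spent. This is what keeps compositions polynomial. *)
Lemma exec_size C s t s' k :
  exec C s t s' -> tree_size (s' k) <= tree_size (s k) + t.
Proof.
elim=> {C s t s'} [s x E|C1 C2 s s1 s2 t1 t2 _ IH1 _ IH2|E C s e0
  |E C s s1 s2 t1 t2 e1 _ IH1 _ IH2]; try lia.
by rewrite /update; case: eqP; lia.
Qed.

Definition run C x t y := exec C (st0 x) t (st0 y).

(* The transformation x i |-> y i, for the indices i satisfying D, is computed
   by a program that uses only variable 0 for its input and output and leaves
   all the others empty, so that such programs can be chained. *)
Definition ptime (I : Type) (D : I -> Prop) (x y : I -> tree) :=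
  exists C (p : {poly nat}), forall i, D i ->
    exists2 t, run C (x i) t (y i) & t <= p.[tree_size (x i)]%R.

Lemma run_size C x t y : run C x t y -> tree_size y <= tree_size x + t.
Proof. by move/exec_size => /(_ 0); rewrite /st0 !update_eq. Qed.

Lemma ptime_size I D (x y : I -> tree) : ptime D x y ->
  exists p : {poly nat}, forall i, D i -> tree_size (y i) <= p.[tree_size (x i)]%R.
Proof.
case=> C [p H]; exists ('X + p)%R => i /H[t /run_size le_y le_t].
by rewrite !horner_natE; apply: leq_trans le_y _; rewrite leq_add2l.
Qed.

Lemma eval_size E : exists p : {poly nat}, forall x,
  tree_size (eval (st0 x) E) <= p.[tree_size x]%R.
Proof.
elim: E => [k|||E [p IH]|E [p IH]] /=.
- exists ('X + 1%:P)%R => x; rewrite !horner_natE /st0 /update.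
  by case: eqP => _; rewrite addn1 //= ltnW.
- by exists 1%:P%R => x; rewrite horner_natE.
- move=> E1 [p1 IH1] E2 [p2 IH2]; exists (p1 + p2 + 1%:P)%R => x.
  by rewrite !horner_natE addn1 ltnS leq_add.
- exists p => x; apply: leq_trans (IH x).
  by case: (eval _ E) => //= a b; rewrite -addnS leq_addr.
- exists p => x; apply: leq_trans (IH x).
  by case: (eval _ E) => //= a b; rewrite -addSn leq_addl.
Qed.

Lemma ptime_expr I D (x : I -> tree) E :
  ptime D x (fun i => eval (st0 (x i)) E).
Proof.
have [p Hp] := eval_size E.
exists (Assign 0 E), (p + 1%:P)%R => i _.
exists (tree_size (eval (st0 (x i)) E)).+1.
  by rewrite /run -[st0 (eval _ _)](update_update _ 0 (x i)); apply: ExecAssign.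
by rewrite !horner_natE addn1 ltnS.
Qed.

Lemma ptime_comp I D (x y z : I -> tree) :
  ptime D x y -> ptime D y z -> ptime D x z.
Proof.
case=> C1 [p1 H1] [C2 [p2 H2]].
exists (Seq C1 C2), (p1 + (p2 \Po ('X + p1)))%R => i Di.
have [t1 r1 le1] := H1 i Di; have [t2 r2 le2] := H2 i Di.
exists (t1 + t2); first exact: ExecSeq r1 r2.
rewrite !horner_natE leq_add //; apply: leq_trans le2 _; apply: leq_horner.
by apply: leq_trans (run_size r1) _; rewrite leq_add2l.
Qed.

Lemma ptime_sub I (D D' : I -> Prop) (x y : I -> tree) :
  (forall i, D' i -> D i) -> ptime D x y -> ptime D' x y.
Proof. by move=> s [C [p H]]; exists C, p => i /s/H. Qed.

Lemma ptime_ext I (D : I -> Prop) (x y y' : I -> tree) :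
  (forall i, D i -> y i = y' i) -> ptime D x y -> ptime D x y'.
Proof. by move=> s [C [p H]]; exists C, p => i Di; rewrite -s //; apply: H. Qed.

Lemma ptime_reindex I J (h : J -> I) (D : I -> Prop) (D' : J -> Prop) x y :
  (forall j, D' j -> D (h j)) -> ptime D x y -> ptime D' (x \o h) (y \o h).
Proof. by move=> s [C [p H]]; exists C, p => j /s/H. Qed.

Lemma exec_assign E v s s' k : eval s E = v -> update s k v = s' ->
  exec (Assign k E) s (tree_size v).+1 s'.
Proof. by move=> <- <-; apply: ExecAssign. Qed.

Section TwoRegisters.

Variable k : nat.
Hypothesis k_gt0 : 0 < k.

Let st2 (a b c : tree) : store := update (update (st0 a) k b) k.+1 c.

Let k_neq0 : k != 0. Proof. by rewrite -lt0n. Qed.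
Let k_neqS : k != k.+1. Proof. by rewrite ltn_eqF. Qed.

Lemma st2_0 a b c : st2 a b c 0 = a.
Proof. by rewrite /st2 !update_neq // update_eq. Qed.

Lemma st2_k a b c : st2 a b c k = b.
Proof. by rewrite /st2 update_neq 1?eq_sym // update_eq. Qed.

Lemma st2_kS a b c : st2 a b c k.+1 = c.
Proof. by rewrite /st2 update_eq. Qed.

Lemma update_st2_0 a b c v : update (st2 a b c) 0 v = st2 v b c.
Proof.
by rewrite /st2 (updateC _ _ _ (_ : k.+1 != 0)) // (updateC _ _ _ k_neq0) /st0
  update_update.
Qed.

Lemma update_st2_k a b c v : update (st2 a b c) k v = st2 a v c.
Proof.
by rewrite /st2 (updateC _ _ _ (_ : k.+1 != k)) 1?eq_sym // update_update.
Qed.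

Lemma update_st2_kS a b c v : update (st2 a b c) k.+1 v = st2 a b v.
Proof. by rewrite /st2 update_update. Qed.

Lemma st2_Leaf a : st2 a Leaf Leaf = st0 a.
Proof.
rewrite /st2; apply/funext => j; rewrite /st0 /update.
case: (j =P k.+1) => [->|_] //; case: (j =P k) => [->|_] //.
by rewrite (negbTE k_neq0).
Qed.

Definition st2E := (st2_0, st2_k, st2_kS, update_st2_0, update_st2_k, update_st2_kS).

Lemma run_st2 C x t y b c : vbound C <= k -> run C x t y ->
  exec C (st2 x b c) t (st2 y b c).
Proof.
move=> Ck r; apply: exec_frame; last exact: leqW.
exact: exec_frame Ck.
Qed.

(** Register [k] saves the input while [C1] runs, and register [k.+1] saves the result of [C1] while
    [C2] runs. Both are emptied again, as [run] requires. *)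
Definition node_cmd C1 C2 : cmd :=
  Seq (Assign k (EVar 0)) (Seq C1 (Seq (Assign k.+1 (EVar 0))
  (Seq (Assign 0 (EVar k)) (Seq (Assign k ENil) (Seq C2
  (Seq (Assign 0 (ECons (EVar k.+1) (EVar 0))) (Assign k.+1 ENil))))))).

Lemma run_node C1 C2 x y z t1 t2 : vbound C1 <= k -> vbound C2 <= k ->
  run C1 x t1 y -> run C2 x t2 z ->
  run (node_cmd C1 C2) x (t1 + t2 + 2 * tree_size x + 2 * tree_size y
    + tree_size z + 9) (Node y z).
Proof.
move=> Ck1 Ck2 r1 r2; rewrite /run -!st2_Leaf.
set T := (X in exec _ _ X _).
have -> : T = (tree_size x).+1 + (t1 + ((tree_size y).+1 + ((tree_size x).+1
  + ((tree_size Leaf).+1 + (t2 + ((tree_size (Node y z)).+1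
  + (tree_size Leaf).+1)))))) by rewrite /T /=; lia.
apply: (ExecSeq (s1 := st2 x x Leaf)); first by apply: exec_assign; rewrite /= ?st2E.
apply: (ExecSeq (s1 := st2 y x Leaf)); first exact: run_st2.
apply: (ExecSeq (s1 := st2 y x y)); first by apply: exec_assign; rewrite /= ?st2E.
apply: (ExecSeq (s1 := st2 x x y)); first by apply: exec_assign; rewrite /= ?st2E.
apply: (ExecSeq (s1 := st2 x Leaf y)); first by apply: exec_assign; rewrite /= ?st2E.
apply: (ExecSeq (s1 := st2 z Leaf y)); first exact: run_st2.
apply: (ExecSeq (s1 := st2 (Node y z) Leaf y)).
  by apply: exec_assign; rewrite /= ?st2E.
by apply: exec_assign; rewrite /= ?st2E.
Qed.

(** A conditional made of two loops that run at most once: register [k] holds the test, and [k.+1]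
    is an else flag that the first branch clears. *)
Definition if_cmd E C1 C2 : cmd :=
  Seq (Assign k E) (Seq (Assign k.+1 (ECons ENil ENil))
  (Seq (While (EVar k) (Seq (Assign k ENil) (Seq (Assign k.+1 ENil) C1)))
    (While (EVar k.+1) (Seq (Assign k.+1 ENil) C2)))).

Lemma run_if_node E C1 C2 x y t : vbound C1 <= k ->
  eval (st0 x) E <> Leaf -> run C1 x t y ->
  run (if_cmd E C1 C2) x (tree_size (eval (st0 x) E) + t + 12) y.
Proof.
move=> Ck e1 r1; rewrite /run.
set v := eval _ _ in e1 *; set T := (X in exec _ _ X _).
have -> : T = (tree_size v).+1 + ((tree_size (Node Leaf Leaf)).+1
  + (((tree_size Leaf).+1 + ((tree_size Leaf).+1 + t) + 1).+1 + 1)).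
  by rewrite /T /=; lia.
apply: (ExecSeq (s1 := st2 x v Leaf)).
  by apply: exec_assign => //; rewrite -st2_Leaf ?st2E.
apply: (ExecSeq (s1 := st2 x v (Node Leaf Leaf))).
  by apply: exec_assign; rewrite /= ?st2E.
apply: (ExecSeq (s1 := st2 y Leaf Leaf)); last first.
  by rewrite -st2_Leaf; apply: ExecWhileDone; rewrite /= st2E.
apply: (ExecWhileLoop (s1 := st2 y Leaf Leaf)).
- by rewrite /= st2E.
- apply: (ExecSeq (s1 := st2 x Leaf (Node Leaf Leaf))).
    by apply: exec_assign; rewrite /= ?st2E.
  apply: (ExecSeq (s1 := st2 x Leaf Leaf)); first by apply: exec_assign; rewrite /= ?st2E.
  exact: run_st2.
- by apply: ExecWhileDone; rewrite /= st2E.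
Qed.

Lemma run_if_leaf E C1 C2 x y t : vbound C2 <= k ->
  eval (st0 x) E = Leaf -> run C2 x t y ->
  run (if_cmd E C1 C2) x (t + 11) y.
Proof.
move=> Ck e0 r2; rewrite /run; set T := (X in exec _ _ X _).
have -> : T = (tree_size Leaf).+1 + ((tree_size (Node Leaf Leaf)).+1
  + (1 + (((tree_size Leaf).+1 + t) + 1).+1)).
  by rewrite /T /=; lia.
apply: (ExecSeq (s1 := st2 x Leaf Leaf)).
  by apply: exec_assign => //; rewrite -st2_Leaf ?st2E.
apply: (ExecSeq (s1 := st2 x Leaf (Node Leaf Leaf))).
  by apply: exec_assign; rewrite /= ?st2E.
apply: (ExecSeq (s1 := st2 x Leaf (Node Leaf Leaf))).
  by apply: ExecWhileDone; rewrite /= st2E.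
apply: (ExecWhileLoop (s1 := st2 y Leaf Leaf)).
- by rewrite /= st2E.
- apply: (ExecSeq (s1 := st2 x Leaf Leaf)); first by apply: exec_assign; rewrite /= ?st2E.
  exact: run_st2.
- by rewrite st2_Leaf; apply: ExecWhileDone.
Qed.

End TwoRegisters.

Lemma ptime_node I D (x y z : I -> tree) :
  ptime D x y -> ptime D x z -> ptime D x (fun i => Node (y i) (z i)).
Proof.
case=> C1 [p1 H1] [C2 [p2 H2]].
pose k := (maxn (vbound C1) (vbound C2)).+1.
exists (node_cmd k C1 C2).
exists ('X + 'X + 'X + 'X + 'X + p1 + p1 + p1 + p2 + p2 + (10%N)%:P)%R => i Di.
have [t1 r1 le1] := H1 i Di; have [t2 r2 le2] := H2 i Di.
eexists; first by apply: run_node r1 r2; rewrite /k; lia.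
have := run_size r1; have := run_size r2.
by rewrite !horner_natE; lia.
Qed.

Lemma ptime_test I (D : I -> Prop) (x y : I -> tree) E :
  ptime (fun i => D i /\ eval (st0 (x i)) E <> Leaf) x y ->
  ptime (fun i => D i /\ eval (st0 (x i)) E = Leaf) x y ->
  ptime D x y.
Proof.
case=> C1 [p1 H1] [C2 [p2 H2]]; have [q Hq] := eval_size E.
pose k := (maxn (vbound C1) (vbound C2)).+1.
exists (if_cmd k E C1 C2), (q + p1 + p2 + (12%N)%:P)%R => i Di.
have := Hq (x i).
have [e0|e1] := pselect (eval (st0 (x i)) E = Leaf).
  have [t r le] := H2 i (conj Di e0).
  eexists; first by apply: run_if_leaf e0 r; rewrite /k; lia.
  by rewrite !horner_natE; lia.
have [t r le] := H1 i (conj Di e1).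
eexists; first by apply: run_if_node e1 r; rewrite /k; lia.
by rewrite !horner_natE; lia.
Qed.

Definition hdT (x : tree) := if x is Node a _ then a else Leaf.
Definition tlT (x : tree) := if x is Node _ b then b else Leaf.
Definition ifT (b y z : tree) := if b is Node _ _ then y else z.

Lemma ptime_id I D (x : I -> tree) : ptime D x x.
Proof. exact: (ptime_expr D x (EVar 0)). Qed.

Lemma ptime_hd I D (x y : I -> tree) :
  ptime D x y -> ptime D x (fun i => hdT (y i)).
Proof. by move=> xy; apply: ptime_comp xy _; apply: (ptime_expr D y (EHd (EVar 0))). Qed.

Lemma ptime_tl I D (x y : I -> tree) :
  ptime D x y -> ptime D x (fun i => tlT (y i)).
Proof. by move=> xy; apply: ptime_comp xy _; apply: (ptime_expr D y (ETl (EVar 0))). Qed.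

Lemma ptime_const I D (x : I -> tree) a : ptime D x (fun=> a).
Proof.
elim: a => [|a IHa b IHb]; first exact: (ptime_expr D x ENil).
exact: ptime_node.
Qed.

(** The test value is paired with the input, and each branch first recovers the input from the pair.
    A branch has to be correct only on the indices that reach it. *)
Lemma ptime_cases I (D : I -> Prop) (x b y : I -> tree) :
  ptime D x b ->
  ptime (fun i => D i /\ b i <> Leaf) x y ->
  ptime (fun i => D i /\ b i = Leaf) x y ->
  ptime D x y.
Proof.
move=> xb y1 y2; apply: (@ptime_comp _ _ _ (fun i => Node (b i) (x i))).
  by apply: ptime_node => //; apply: ptime_id.
have tail D' : ptime D' (fun i => Node (b i) (x i)) x.
  by apply: (ptime_expr _ _ (ETl (EVar 0))).
apply: (ptime_test (E := EHd (EVar 0))).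
  exact: ptime_comp (tail _) y1.
exact: ptime_comp (tail _) y2.
Qed.

Lemma ptime_if I D (x b y z : I -> tree) :
  ptime D x b -> ptime D x y -> ptime D x z ->
  ptime D x (fun i => ifT (b i) (y i) (z i)).
Proof.
move=> xb xy xz; apply: (ptime_cases xb).
  apply: (@ptime_ext _ _ _ y) => [i [_]|]; first by case: (b i).
  by apply: ptime_sub xy => i [].
apply: (@ptime_ext _ _ _ z) => [i [_ ->] //|].
by apply: ptime_sub xz => i [].
Qed.

Lemma exec_iter E C s (n : nat) (t : nat) :
  (forall j, j < n -> eval (s j) E <> Leaf) -> eval (s n) E = Leaf ->
  (forall j, j < n -> exists2 u, exec C (s j) u (s j.+1) & u <= t) ->
  exists2 u, exec (While E C) (s 0) u (s n) & u <= n * t.+1 + 1.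
Proof.
elim: n s => [|n IH] s He Hn HC.
  by exists 1; [apply: ExecWhileDone|].
have [u r le] := HC 0 isT.
have [|//||v r' le'] := IH (s \o succn).
- by move=> j jn; apply: He.
- by move=> j jn; apply: HC.
exists (u + v).+1; last by rewrite mulSn; lia.
by apply: ExecWhileLoop r r'; apply: He.
Qed.

(** Iterating a polynomial size bound could explode, so one polynomial [q] in the size of the
    initial state bounds both the number of rounds and every intermediate state. The body is one
    program, uniform in the round [j]. *)
Lemma ptime_while I (D : I -> Prop) (g : I -> nat -> tree) (n : I -> nat)
    (q : {poly nat}) :
  (forall i j, D i -> j < n i -> hdT (g i j) <> Leaf) ->
  (forall i, D i -> hdT (g i (n i)) = Leaf) ->
  (forall i, D i -> n i <= q.[tree_size (g i 0)]%R) ->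
  (forall i j, D i -> j < n i -> tree_size (g i j) <= q.[tree_size (g i 0)]%R) ->
  ptime (fun ij : I * nat => D ij.1 /\ ij.2 < n ij.1)
    (fun ij => g ij.1 ij.2) (fun ij => g ij.1 ij.2.+1) ->
  ptime D (fun i => g i 0) (fun i => g i (n i)).
Proof.
move=> He Hn Hq Hs [C [p HC]].
exists (While (EHd (EVar 0)) C), (q * ((p \Po q) + 1%:P) + 1%:P)%R => i Di.
have [||j jn|u r le] := @exec_iter (EHd (EVar 0)) C (fun j => st0 (g i j)) (n i)
  p.[q.[tree_size (g i 0)]]%R.
- by move=> j jn; apply: He.
- exact: Hn.
- have [u r le] := HC (i, j) (conj Di jn); exists u => //.
  by apply: leq_trans le _; apply: leq_horner; apply: Hs.
exists u => //; apply: leq_trans le _.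
by rewrite !horner_natE leq_add2r addn1 leq_mul2r Hq ?orbT.
Qed.

(** * Lists as trees, and list programs *)

Fixpoint dec (t : tree) : seq tree := if t is Node a b then a :: dec b else [::].

(** Together with [enc_seqK]: every tree codes exactly one list along its right spine, so list
    programs are total on trees. *)
Lemma decK : cancel dec enc_seq.
Proof. by elim=> //= a _ b ->. Qed.

Lemma enc_seqK : cancel enc_seq dec.
Proof. by elim=> //= a s ->. Qed.

Lemma size_dec t : size (dec t) <= tree_size t.
Proof. by elim: t => //= a _ b IH; rewrite ltnS (leq_trans IH) ?leq_addl. Qed.

Lemma tree_size_drop s j : tree_size (enc_seq (drop j s)) <= tree_size (enc_seq s).
Proof.
elim: s j => [|a s IH] [|j] //=; apply: leq_trans (IH j) _.
by rewrite -addSn leq_addl.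
Qed.

Lemma ptime_app I (D : I -> Prop) (x y : I -> tree) (f : tree -> tree) :
  ptime D x y -> ptime (fun=> True) id f -> ptime D x (fun i => f (y i)).
Proof.
move=> xy Pf; apply: ptime_comp xy _.
exact: (ptime_reindex (h := y) (D' := D) _ Pf).
Qed.

Lemma ptime_foldl I (D : I -> Prop) (f : tree -> tree -> tree -> tree)
    (x c L a : I -> tree) :
  ptime (fun=> True) id (fun z => f (hdT z) (hdT (tlT z)) (tlT (tlT z))) ->
  ptime D x c -> ptime D x L -> ptime D x a ->
  (exists q : {poly nat}, forall i j, D i -> tree_size (foldl
     (fun acc e => f (c i) e acc) (a i) (take j (dec (L i)))) <=
     q.[tree_size (x i)]%R) ->
  ptime D x (fun i => foldl (fun acc e => f (c i) e acc) (a i) (dec (L i))).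
Proof.
move=> Pf xc xL xa [q Hq].
pose s i := dec (L i).
pose acc i j := foldl (fun b e => f (c i) e b) (a i) (take j (s i)).
(* The loop state holds the remaining list, the context with the original input, and the
   accumulator. The input rides along so that a bound in its size is also a bound in the size of the
   initial state. *)
pose g i j := Node (enc_seq (drop j (s i))) (Node (Node (c i) (x i)) (acc i j)).
suff H : ptime D (fun i => g i 0) (fun i => g i (size (s i))).
  apply: (@ptime_comp _ _ _ (fun i => g i 0)).
    apply: ptime_node; first by apply: ptime_ext xL => i _; rewrite drop0 decK.
    apply: ptime_node; first exact: ptime_node xc (ptime_id _ _).
    by apply: ptime_ext xa => i _; rewrite /acc take0.
  apply: ptime_comp H _.
  apply: (@ptime_ext _ _ _ (fun i => tlT (tlT (g i (size (s i)))))) => [i _|].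
    by rewrite /= /acc take_size.
  by do 2!apply: ptime_tl; apply: ptime_id.
have le0 i : tree_size (x i) <= tree_size (g i 0) by rewrite /=; lia.
have leL i : size (s i) <= tree_size (g i 0).
  by rewrite /= drop0 decK; apply: leq_trans (size_dec (L i)) _; lia.
apply: (@ptime_while _ _ _ _ (q + 'X + 'X + (1%N)%:P)%R).
- by move=> i j _ ji; rewrite /= (drop_nth Leaf ji).
- by move=> i _; rewrite /= drop_size.
- move=> i _; move: (tree_size _) (leL i) => k; rewrite !horner_natE; lia.
- move=> i j Di ji; have := leq_horner q (le0 i); have := Hq i j Di.
  have := tree_size_drop (s i) j; rewrite -/(acc i j).
  have -> : tree_size (g i 0) = (tree_size (enc_seq (s i)) + ((tree_size (c i) +
    tree_size (x i)).+1 + tree_size (acc i 0)).+1).+1 by rewrite /= drop0.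
  by rewrite /=; move: (tree_size _) => k; rewrite !horner_natE; lia.
pose F z := Node (tlT (hdT z)) (Node (hdT (tlT z))
  (f (hdT (hdT (tlT z))) (hdT (hdT z)) (tlT (tlT z)))).
apply: (@ptime_ext _ _ _ (fun ij => F (g ij.1 ij.2))) => [[i j] [_ /= ji]|].
  have accS : acc i j.+1 = f (c i) (nth Leaf (s i) j) (acc i j).
    by rewrite /acc (take_nth Leaf ji) -cats1 foldl_cat.
  by rewrite /F /g accS (drop_nth Leaf ji).
apply: ptime_app; first exact: ptime_id.
have P0 := ptime_id (I := tree) (fun=> True) id.
apply: ptime_node; first exact/ptime_tl/ptime_hd.
apply: ptime_node; first exact/ptime_hd/ptime_tl.
apply: (@ptime_ext _ _ _ (fun z => (fun w => f (hdT w) (hdT (tlT w)) (tlT (tlT w)))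
  (Node (hdT (hdT (tlT z))) (Node (hdT (hdT z)) (tlT (tlT z)))))) => //.
apply: ptime_app Pf.
apply: ptime_node; first exact/ptime_hd/ptime_hd/ptime_tl.
by apply: ptime_node; [exact/ptime_hd/ptime_hd|exact/ptime_tl/ptime_tl].
Qed.

Definition revT (u : tree) := foldl (fun acc e => Node e acc) Leaf (dec u).
Definition catT (u v : tree) := foldl (fun acc e => Node e acc) v (dec (revT u)).
Definition dropT (u v : tree) := foldl (fun acc _ => tlT acc) v (dec u).
Definition mapT (f : tree -> tree) (u : tree) := enc_seq (map f (dec u)).

Lemma foldl_Node s t :
  foldl (fun acc e => Node e acc) (enc_seq t) s = enc_seq (catrev s t).
Proof. by elim: s t => //= a s IH t; rewrite -IH. Qed.

Lemma revTE s : revT (enc_seq s) = enc_seq (rev s).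
Proof. by rewrite /revT enc_seqK (foldl_Node s [::]). Qed.

Lemma catTE s t : catT (enc_seq s) (enc_seq t) = enc_seq (s ++ t).
Proof. by rewrite /catT revTE enc_seqK foldl_Node catrevE revK. Qed.

Lemma dropTE s t : dropT (enc_seq s) (enc_seq t) = enc_seq (drop (size s) t).
Proof.
rewrite /dropT enc_seqK; elim: s t => [|a s IH] t /=; first by rewrite drop0.
by case: t => [|b t] /=; [rewrite (IH [::]) | rewrite IH].
Qed.

Lemma mapTE f s : mapT f (enc_seq s) = enc_seq (map f s).
Proof. by rewrite /mapT enc_seqK. Qed.

Lemma tree_size_foldl_Node s v j :
  tree_size (foldl (fun acc e => Node e acc) v (take j s)) <=
  tree_size v + tree_size (enc_seq s).
Proof.
elim: s v j => [|a s IH] v [|j] /=; rewrite ?leq_addr //.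
by apply: leq_trans (IH _ _) _ => /=; lia.
Qed.

Section Closure.

Variables (I : Type) (D : I -> Prop) (x : I -> tree).

Lemma ptime_foldl_Node (u v : I -> tree) : ptime D x u -> ptime D x v ->
  ptime D x (fun i => foldl (fun acc e => Node e acc) (v i) (dec (u i))).
Proof.
move=> xu xv.
apply: (@ptime_foldl _ _ (fun _ e acc => Node e acc) _ (fun=> Leaf)) => //.
- have P0 := ptime_id (I := tree) (fun=> True) id.
  by apply: ptime_node; [exact/ptime_hd/ptime_tl|exact/ptime_tl/ptime_tl].
- exact: ptime_const.
have [p Hp] := ptime_size xu; have [q Hq] := ptime_size xv.
exists (p + q)%R => i j Di; apply: leq_trans (tree_size_foldl_Node _ _ _) _.
by rewrite decK !horner_natE addnC leq_add ?Hp ?Hq.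
Qed.

Lemma ptime_rev (u : I -> tree) : ptime D x u -> ptime D x (fun i => revT (u i)).
Proof. by move=> xu; apply: ptime_foldl_Node xu (ptime_const _ _ _). Qed.

Lemma ptime_cat (u v : I -> tree) : ptime D x u -> ptime D x v ->
  ptime D x (fun i => catT (u i) (v i)).
Proof. by move=> xu xv; apply: ptime_foldl_Node => //; apply: ptime_rev. Qed.

Lemma ptime_drop (u v : I -> tree) : ptime D x u -> ptime D x v ->
  ptime D x (fun i => dropT (u i) (v i)).
Proof.
move=> xu xv.
apply: (@ptime_foldl _ _ (fun _ _ acc => tlT acc) _ (fun=> Leaf)) => //.
- by do 3!apply: ptime_tl; apply: ptime_id.
- exact: ptime_const.
have [q Hq] := ptime_size xv; exists q => i j Di.
apply: leq_trans (Hq i Di).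
elim: (take _ _) (v i) => //= a s IH w; apply: leq_trans (IH _) _.
by case: w => //= b w; lia.
Qed.

(** A program has no free parameters, so those of the mapped function travel in the context [c]. The
    results are accumulated in reverse and reversed at the end. *)
Lemma ptime_map (f : tree -> tree -> tree) (c u : I -> tree) :
  ptime (fun=> True) id (fun z => f (hdT z) (tlT z)) ->
  ptime D x c -> ptime D x u -> ptime D x (fun i => mapT (f (c i)) (u i)).
Proof.
move=> Pf xc xu.
apply: (@ptime_ext _ _ _ (fun i => revT (foldl
  (fun acc e => Node (f (c i) e) acc) Leaf (dec (u i))))) => [i _|].
  have aux s t : foldl (fun acc e => Node (f (c i) e) acc) (enc_seq t) s =
      enc_seq (catrev (map (f (c i)) s) t).
    by elim: s t => //= a s IH t; rewrite -IH.
  by rewrite (aux _ [::]) revTE catrevE cats0 revK.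
apply: ptime_rev.
apply: (@ptime_foldl _ _ (fun c e acc => Node (f c e) acc)) => //.
- have P0 := ptime_id (I := tree) (fun=> True) id.
  apply: ptime_node; last exact/ptime_tl/ptime_tl.
  apply: (@ptime_ext _ _ _ (fun z => (fun w => f (hdT w) (tlT w))
    (Node (hdT z) (hdT (tlT z))))) => //.
  by apply: ptime_app Pf; apply: ptime_node; [exact/ptime_hd|exact/ptime_hd/ptime_tl].
- exact: ptime_const.
have [p Hp] := ptime_size xc; have [q Hq] := ptime_size xu.
have [r Hr] := ptime_size Pf.
exists (q * ((r \Po (p + q + (1%N)%:P)) + (1%N)%:P) + (1%N)%:P)%R => i j Di.
rewrite !horner_natE.
set Q := q.[_]%R; set b := r.[_]%R.
have lt_s : size (take j (dec (u i))) <= Q.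
  by rewrite size_take_min geq_min (leq_trans (size_dec _) (Hq i Di)) orbT.
(* Each of the at most [Q] results adds at most [b + 1] to the accumulated list, which starts at
   size 1. *)
apply: leq_trans (_ : size (take j (dec (u i))) * (b + 1) + 1 <= _); last first.
  by rewrite leq_add2r leq_mul2r lt_s orbT.
have : tree_size (enc_seq (take j (dec (u i)))) <= Q.
  apply: leq_trans (Hq i Di); rewrite -{2}[u i]decK.
  elim: (dec (u i)) j {lt_s} => [|a s IH] [|j] //=.
  by have := IH j; lia.
have -> : size (take j (dec (u i))) * (b + 1) + 1 =
  size (take j (dec (u i))) * (b + 1) + tree_size Leaf by [].
elim: (take _ _) (Leaf) {lt_s} => [|a s IH] w /= le_Q; first by rewrite leq_addl.
apply: leq_trans (IH _ _) _; first by lia.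
have -> : forall X, (size s).+1 * (b + 1) + X = size s * (b + 1) + (b + 1 + X).
  by move=> X; rewrite mulSn; lia.
rewrite leq_add2l /= addn1 addSn ltnS leq_add2r.
have /= /leq_trans := Hr (Node (c i) a) Logic.I; apply; apply: leq_horner.
have := Hp i Di; rewrite -/Q; lia.
Qed.

End Closure.

(** * The reduction as a program *)

Definition tru := Node Leaf Leaf.
(** Programs compute with numbers in unary, any list standing for its length: concatenation adds,
    and [dropT] subtracts and compares. *)
Definition unary k := enc_seq (nseq k Leaf).
Definition unT u := mapT (fun=> Leaf) u.
(** The start value [tru] is also the code of [[:: unary 0]]. Each round puts the successor of the
    head in front; the surplus last number is removed before reversing. *)
Definition iotaT u :=
  revT (tlT (foldl (fun acc _ => Node (Node Leaf (hdT acc)) acc) tru (dec u))).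
Definition eqlenT u v := ifT (dropT u v) Leaf (ifT (dropT v u) Leaf tru).

Lemma iotaSr n : iota 0 n.+1 = rcons (iota 0 n) n.
Proof. by rewrite -addn1 iotaD add0n -cats1. Qed.

Lemma tree_size_unary k : tree_size (unary k) = (2 * k).+1.
Proof. by rewrite /unary; elim: k => //= k ->; lia. Qed.

Lemma unTE s : unT (enc_seq s) = unary (size s).
Proof. by rewrite /unT mapTE /unary; congr enc_seq; elim: s => //= a s ->. Qed.

Lemma iotaT_loop (s : seq tree) :
  foldl (fun acc _ => Node (Node Leaf (hdT acc)) acc) tru s =
  enc_seq (rev (map unary (iota 0 (size s).+1))).
Proof.
elim/last_ind: s => // s a IH; rewrite foldl_rcons IH size_rcons.
by rewrite !iotaSr !map_rcons !rev_rcons.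
Qed.

Lemma iotaTE s : iotaT (enc_seq s) = enc_seq (map unary (iota 0 (size s))).
Proof.
rewrite /iotaT enc_seqK iotaT_loop iotaSr map_rcons rev_rcons /=.
by rewrite revTE revK.
Qed.

Lemma enc_boolE b y z : ifT (enc_bool b) y z = if b then y else z.
Proof. by case: b. Qed.

Lemma ifT_drop u s y z :
  ifT (dropT (enc_seq u) (enc_seq s)) y z = if size u < size s then y else z.
Proof.
rewrite dropTE; case: ltnP => h; last by rewrite drop_oversize.
by rewrite (drop_nth Leaf h).
Qed.

Lemma eqlenTE s t : eqlenT (enc_seq s) (enc_seq t) = enc_bool (size s == size t).
Proof. by rewrite /eqlenT !ifT_drop; case: ltngtP. Qed.

Lemma hd_dropT s t : hdT (dropT (enc_seq s) (enc_seq t)) = nth Leaf t (size s).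
Proof.
rewrite dropTE; case: (ltnP (size s) (size t)) => h.
  by rewrite (drop_nth Leaf h).
by rewrite drop_oversize // nth_default.
Qed.

Section Closure.

Variables (I : Type) (D : I -> Prop) (x : I -> tree).

Lemma ptime_un (u : I -> tree) : ptime D x u -> ptime D x (fun i => unT (u i)).
Proof.
move=> xu; apply: (@ptime_map _ _ _ (fun _ _ => Leaf) (fun=> Leaf)) => //.
  exact: ptime_const.
exact: ptime_const.
Qed.

Lemma ptime_iota (u : I -> tree) : ptime D x u -> ptime D x (fun i => iotaT (u i)).
Proof.
move=> xu; apply/ptime_rev/ptime_tl.
apply: (@ptime_foldl _ _ (fun _ _ acc => Node (Node Leaf (hdT acc)) acc) _
  (fun=> Leaf) u (fun=> tru)) => //.
- have P : ptime (fun=> True) id (fun z : tree => tlT (tlT z)).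
    by do 2!apply: ptime_tl; apply: ptime_id.
  exact: ptime_node (ptime_node (ptime_const _ _ _) (ptime_hd P)) P.
- exact: ptime_const.
- exact: ptime_const.
have [q Hq] := ptime_size xu.
exists ((q + (1%N)%:P) * ((2%N)%:P * q + (2%N)%:P) + (1%N)%:P)%R => i j Di.
rewrite iotaT_loop !horner_natE -map_rev.
set Q := q.[_]%R; have ltQ : size (take j (dec (u i))) <= Q.
  by rewrite size_take_min geq_min (leq_trans (size_dec _) (Hq i Di)) orbT.
apply: leq_trans (_ : (size (take j (dec (u i)))).+1 * (2 * Q + 2) + 1 <= _);
  last by rewrite leq_add2r leq_mul2r; lia.
set k := size _ in ltQ *.
have : all (fun a => a <= Q) (rev (iota 0 k.+1)).
  by apply/allP => a; rewrite mem_rev mem_iota; lia.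
have -> : k.+1 = size (rev (iota 0 k.+1)) by rewrite size_rev size_iota.
rewrite {1 2}size_rev {1 2}size_iota.
elim: (rev _) => //= a s IH /andP[aQ /IH].
by rewrite tree_size_unary mulSn; lia.
Qed.

Lemma ptime_eqlen (u v : I -> tree) :
  ptime D x u -> ptime D x v -> ptime D x (fun i => eqlenT (u i) (v i)).
Proof.
move=> xu xv; have P0 := @ptime_const _ D x.
apply: ptime_if; [exact: ptime_drop|exact: P0|].
by apply: ptime_if; [exact: ptime_drop|exact: P0|exact: P0].
Qed.

End Closure.

Ltac pt_step := first
  [ assumption | exact: ptime_id | exact: ptime_const | apply: ptime_node
  | apply: ptime_hd | apply: ptime_tl | apply: ptime_if | apply: ptime_drop
  | apply: ptime_cat | apply: ptime_un | apply: ptime_iota | apply: ptime_eqlen ].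

Ltac pt := repeat pt_step.

(** * Finite tables *)

Fixpoint eqT (a x : tree) : tree :=
  if a is Node a1 a2 then ifT x (ifT (eqT a1 (hdT x)) (eqT a2 (tlT x)) Leaf) Leaf
  else ifT x Leaf tru.

Lemma eqTP a x : eqT a x <> Leaf <-> x = a.
Proof.
elim: a x => [|a1 IH1 a2 IH2] [|b1 b2] //=.
have [j1 j2] := IH1 b1; have [i1 i2] := IH2 b2.
case: (eqT a1 b1) j1 j2 => [|u v] /= j1 j2.
  by split=> [|[/j2]].
by split=> [/i1->|[_ /i2]//]; rewrite j1.
Qed.

Lemma ptime_eqT a : ptime (fun=> True) id (eqT a).
Proof.
elim: a => [|a1 IH1 a2 IH2] /=; first by pt.
apply: ptime_if; first exact: ptime_id; last exact: ptime_const.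
apply: ptime_if; last exact: ptime_const.
  by apply: ptime_app IH1; pt.
by apply: ptime_app IH2; pt.
Qed.

(** The program compares its input with each tree of [s] in turn and returns a hard-wired answer, so
    [g] may be an arbitrary function. *)
Lemma ptime_table (g : tree -> tree) (s : seq tree) :
  ptime (fun x => List.In x s) id g.
Proof.
elim: s => [|a s IH]; first by exists (Assign 0 ENil), 0%R.
apply: (@ptime_cases _ _ _ (eqT a)).
- by apply: ptime_sub (ptime_eqT a) => x.
- apply: (@ptime_ext _ _ _ (fun=> g a)) => [x [_ xa]|].
    by rewrite ((eqTP a x).1 xa).
  exact: ptime_const.
apply: ptime_sub IH => x [[<-|//]].
by have [_ /(_ erefl)] := eqTP a a.
Qed.

Lemma tree_size_finite n : exists s, forall x, tree_size x <= n -> List.In x s.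
Proof.
elim: n => [|n [s Hs]]; first by exists [::] => -[].
exists (Leaf :: List.flat_map (fun a => List.map (Node a) s) s) => -[|a b] /=; first by left.
rewrite ltnS => le; right.
have /Hs ina : tree_size a <= n by lia.
have /Hs inb : tree_size b <= n by lia.
by apply/List.in_flat_map; exists a; split => //; apply: List.in_map.
Qed.

(** Only finitely many trees have size at most [n], and the second hypothesis makes the output
    depend on the input code alone, so a table suffices. *)
Lemma ptime_finite I (D : I -> Prop) (x y : I -> tree) n :
  (forall i, D i -> tree_size (x i) <= n) ->
  (forall i j, D i -> D j -> x i = x j -> y i = y j) ->
  ptime D x y.
Proof.
move=> xn xy; have [s Hs] := tree_size_finite n.
have [g Hg] : exists g, forall i, D i -> g (x i) = y i.
  pose P t z := forall i, D i -> x i = t -> y i = z.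
  have /choice[g Hg] t : exists z, P t z.
    have [[i [Di xi]]|no] := pselect (exists i, D i /\ x i = t).
      by exists (y i) => j Dj xj; apply: xy => //; rewrite xi.
    by exists Leaf => i Di xi; case: no; exists i.
  by exists g => i Di; rewrite (Hg _ i Di erefl).
apply: (@ptime_ext _ _ _ (g \o x)) => //.
apply: (ptime_reindex (h := x) _ (ptime_table g s)) => i Di.
exact/Hs/xn.
Qed.

(* A vertex is handled as Node depth (Node kind (Node index row)): depth and
   index are unary, kind is a Node exactly on the branches of the sets, and row
   is then the incidence row of the set. *)
Definition depT d := hdT d.
Definition kindT d := hdT (tlT d).
Definition idxT d := hdT (tlT (tlT d)).
Definition rowT d := tlT (tlT (tlT d)).

Definition sameT d d' :=
  ifT (kindT d) (ifT (kindT d') (eqlenT (idxT d) (idxT d')) Leaf)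
    (ifT (kindT d') Leaf (eqlenT (idxT d) (idxT d'))).

Definition atT k d := ifT (kindT d) (eqlenT (depT d) (unary k)) Leaf.

Definition incT d d' :=
  ifT (kindT d) (ifT (kindT d') Leaf (hdT (dropT (idxT d') (rowT d))))
    (ifT (kindT d') (hdT (dropT (idxT d) (rowT d'))) tru).

(** The code of the rational 2^k, with k the length of [u]: k zero bits followed by a one, over
    denominator 1. Exponents linear in N thus give weights of polynomial code size. *)
Definition powT u := Node (catT (unT u) (enc_seq [:: tru])) (enc_nat 1).

(** The number of elements is read off as the length of the first row, the number of sets as the
    length of the matrix. *)
Definition branchesT x :=
  catT (mapT (fun k => Node Leaf (Node k Leaf)) (iotaT (unT (hdT x))))
    (mapT (fun k => Node tru (Node k (hdT (dropT k x)))) (iotaT (unT x))).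

(** Vertices are listed depth by depth, all bases first. This order matches the numbering by
    ordinals and later serves as the elimination order. The recursion on [T] is unrolled into the
    program. *)
Fixpoint vertsT T x :=
  if T is T'.+1 then
    catT (vertsT T' x) (mapT (fun b => Node (unary T') b) (branchesT x))
  else Leaf.

Section Reduction.

Variables l K : nat.

(** All branches have l + 2 vertices, which keeps the numbering uniform; the vertex at depth l + 1
    of an element branch stays isolated. *)
Definition stepT d d' :=
  ifT (eqlenT (Node Leaf (depT d)) (depT d'))
    (ifT (kindT d) tru (ifT (dropT (depT d) (unary l)) tru Leaf)) Leaf.

Definition adjT d d' :=
  ifT (sameT d d') (ifT (stepT d d') tru (stepT d' d))
    (ifT (depT d) Leaf (ifT (depT d') Leaf (incT d d'))).

(** The vertex list [V] serves as the number N in unary; the three exponents are 0, 2N and 4N +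
    K. *)
Definition weightT V d d' :=
  ifT (ifT (atT l.+1 d) tru (atT l.+1 d')) (powT Leaf)
    (ifT (ifT (atT l d) tru (atT l d')) (powT (catT V V))
      (powT (catT (catT V V) (catT (catT V V) (unary K))))).

Definition entryT x d d' := ifT (adjT d d') (weightT (vertsT l.+2 x) d d') Leaf.

Definition entry_rowT x d := mapT (entryT x d) (vertsT l.+2 x).

Definition graphT x := mapT (entry_rowT x) (vertsT l.+2 x).

(** Entry number t B + n + k of [M], with B the number of branches: the position of the vertex at
    depth t on the branch of the set k. *)
Definition skipT x t k M := hdT (dropT k (dropT (hdT x) (iter t (dropT (branchesT x)) M))).

(** The entry of the output matrix for e_k: row at depth l - 1, column at depth l, on the branch of
    the set k. *)
Definition bitT z k := skipT (hdT z) l k (skipT (hdT z) l.-1 k (tlT z)).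

Definition coverT z := mapT (bitT z) (iotaT (unT (hdT z))).

Lemma ptime_branches I (D : I -> Prop) (x y : I -> tree) :
  ptime D x y -> ptime D x (fun i => branchesT (y i)).
Proof.
move=> xy; apply: ptime_cat.
  apply: (@ptime_map _ _ _ (fun _ k => Node Leaf (Node k Leaf)) (fun=> Leaf)).
  - by pt.
  - exact: ptime_const.
  - by pt.
apply: (@ptime_map _ _ _ (fun x k => Node tru (Node k (hdT (dropT k x)))) y) => //.
  by pt.
by pt.
Qed.

Lemma ptime_verts I (D : I -> Prop) (x y : I -> tree) T :
  ptime D x y -> ptime D x (fun i => vertsT T (y i)).
Proof.
move=> xy; elim: T => [|T IH] /=; first by pt.
apply: ptime_cat => //.
apply: (@ptime_map _ _ _ (fun _ b => Node (unary T) b) (fun=> Leaf)).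
- by pt.
- exact: ptime_const.
- exact: ptime_branches.
Qed.

Ltac pt' := repeat first [ apply: ptime_verts | apply: ptime_branches | pt_step ].

Lemma ptime_entry I (D : I -> Prop) (x y d d' : I -> tree) :
  ptime D x y -> ptime D x d -> ptime D x d' ->
  ptime D x (fun i => entryT (y i) (d i) (d' i)).
Proof.
by move=> xy xd xd'; rewrite /entryT /adjT /weightT /stepT /sameT /incT /atT
  /powT /depT /kindT /idxT /rowT; pt'.
Qed.

Lemma ptime_graph I (D : I -> Prop) (x y : I -> tree) :
  ptime D x y -> ptime D x (fun i => graphT (y i)).
Proof.
move=> xy; apply: (@ptime_map _ _ _ entry_rowT y) => //; last exact: ptime_verts.
apply: (@ptime_map _ _ _ (fun c d => entryT (hdT c) (tlT c) d)
  (fun z => Node (hdT z) (tlT z))).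
- by apply: ptime_entry; pt.
- by pt.
- by pt'.
Qed.

Lemma ptime_skip I (D : I -> Prop) (x y k M : I -> tree) t :
  ptime D x y -> ptime D x k -> ptime D x M ->
  ptime D x (fun i => skipT (y i) t (k i) (M i)).
Proof.
move=> xy xk xM; apply: ptime_hd; apply: ptime_drop => //.
apply: ptime_drop; first exact: ptime_hd.
by elim: t => //= t IH; apply: ptime_drop => //; apply: ptime_branches.
Qed.

Lemma ptime_cover I (D : I -> Prop) (x z : I -> tree) :
  ptime D x z -> ptime D x (fun i => coverT (z i)).
Proof.
move=> xz; apply: (@ptime_map _ _ _ bitT z) => //; last by pt.
by do ![apply: ptime_skip | by pt].
Qed.

End Reduction.

(** * The graph in arithmetic form, and correctness of the programs *)

Lemma enc_nat_pow2 k : enc_nat (2 ^ k) = enc_seq (rcons (nseq k Leaf) tru).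
Proof.
rewrite /enc_nat (@up_log_eq _ k) //; last by rewrite expnS ltnS leqnn /=; lia.
rewrite iotaSr map_rcons divnn expn_gt0 /=; congr (enc_seq (rcons _ _)).
rewrite -[RHS](map_id) -[in RHS](size_iota 0 k); apply/esym.
have : all (fun i => i < k) (iota 0 k) by apply/allP => i; rewrite mem_iota.
elim: (iota 0 k) => //= i s IH /andP[ik /IH->].
rewrite -expnB // 1?ltnW // oddX /= orbF subn_eq0 leqNgt ik //.
Qed.

Definition pow2 k : rat := ((2 ^ k)%N%:R)%R.

Section Spec.

Variables (l K n : nat) (rows : seq (seq bool)).
Hypothesis size_row : size (head [::] rows) = n.

Let xs := [seq enc_seq (map enc_bool r) | r <- rows].
Let x := enc_seq xs.
Let B := n + size rows.

Definition mem_row j k := nth false (nth [::] rows k) j.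

Definition incident j j' :=
  if n <= j then (if n <= j' then false else mem_row j' (j - n))
  else (if n <= j' then mem_row j (j' - n) else true).

(** A vertex [u] has depth [u %/ B] and branch [u %% B]; the branches below [n] are those of the
    elements. *)
Definition step u v :=
  (v %/ B == (u %/ B).+1) && ((n <= u %% B) || (u %/ B < l)).

Definition vadj u v :=
  if u %% B == v %% B then step u v || step v u
  else [&& u %/ B == 0, v %/ B == 0 & incident (u %% B) (v %% B)].

Definition at_depth k u := (n <= u %% B) && (u %/ B == k).

Definition wexp u v :=
  if at_depth l.+1 u || at_depth l.+1 v then 0
  else if at_depth l u || at_depth l v then 2 * (l.+2 * B)
  else 4 * (l.+2 * B) + K.

Definition entry u v :=
  if vadj u v then enc_posrat (pow2 (wexp u v)) else Leaf.

Definition bdesc j :=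
  if n <= j then Node tru (Node (unary (j - n)) (nth Leaf xs (j - n)))
  else Node Leaf (Node (unary j) Leaf).

Definition desc v := Node (unary (v %/ B)) (bdesc (v %% B)).

Lemma size_hd_x : exists2 s, hdT x = enc_seq s & size s = n.
Proof.
rewrite /x /xs; case: rows size_row => [|r rs] /= sz.
  by exists [::].
by exists (map enc_bool r); rewrite ?size_map.
Qed.

Lemma branchesTE : branchesT x = enc_seq (map bdesc (iota 0 B)).
Proof.
have [s hx sz] := size_hd_x.
rewrite /branchesT hx !unTE {1}/unary !iotaTE !size_nseq !mapTE catTE sz.
rewrite iotaD map_cat add0n -!map_comp; congr (enc_seq (_ ++ _)).
  by apply/eq_in_map => j; rewrite mem_iota /bdesc /= add0n => jn; rewrite leqNgt jn.
rewrite -[n in RHS]addn0 iotaDl -map_comp size_map; apply/eq_in_map => k.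
by rewrite mem_iota /bdesc /= leq_addr addKn hd_dropT size_nseq.
Qed.

Lemma size_branches : size (map bdesc (iota 0 B)) = B.
Proof. by rewrite size_map size_iota. Qed.

Lemma vertsTE T : vertsT T x = enc_seq (map desc (iota 0 (T * B))).
Proof.
elim: T => //= T IH; rewrite IH branchesTE mapTE catTE mulSn [B + _]addnC iotaD map_cat.
congr (enc_seq (_ ++ _)); rewrite add0n -[in RHS](addn0 (T * B)) iotaDl -!map_comp.
apply/eq_in_map => j; rewrite mem_iota /= add0n => jB.
by rewrite /desc divnMDl ?modnMDl ?(leq_ltn_trans _ jB) // divn_small ?modn_small ?addn0.
Qed.

Lemma sameTE u v : sameT (desc u) (desc v) = enc_bool (u %% B == v %% B).
Proof.
rewrite /sameT /desc /bdesc /kindT /idxT /=.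
case: ifP => hu; case: ifP => hv /=; rewrite ?eqlenTE ?size_nseq //.
- by congr enc_bool; lia.
- by rewrite (_ : _ == _ = false) //; lia.
- by rewrite (_ : _ == _ = false) //; lia.
Qed.

Lemma stepTE u v : stepT l (desc u) (desc v) = enc_bool (step u v).
Proof.
rewrite /stepT /step /desc /bdesc /kindT /depT /=.
rewrite -[Node Leaf _]/(unary (u %/ B).+1) eqlenTE !size_nseq enc_boolE eq_sym.
case: eqP => //= _; case: ifP => //= _.
by rewrite ifT_drop !size_nseq; case: ltnP.
Qed.

Lemma incTE u v : incT (desc u) (desc v) = enc_bool (incident (u %% B) (v %% B)).
Proof.
have nthE j k : hdT (dropT (unary j) (nth Leaf xs k)) = enc_bool (mem_row j k).
  rewrite /mem_row /xs; case: (ltnP k (size rows)) => kr.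
    rewrite (nth_map [::]) // hd_dropT size_nseq.
    case: (ltnP j (size (nth [::] rows k))) => jr; first by rewrite (nth_map false).
    by rewrite nth_default ?size_map // (nth_default false).
  rewrite nth_default ?size_map // (nth_default [::]) // nth_nil.
  by rewrite (hd_dropT _ [::]) nth_nil.
rewrite /incT /incident /desc /bdesc /kindT /idxT /rowT /=.
by case: ifP => hu; case: ifP => hv /=.
Qed.

Lemma adjTE u v : adjT l (desc u) (desc v) = enc_bool (vadj u v).
Proof.
rewrite /adjT sameTE !stepTE incTE !enc_boolE /vadj.
case: eqP => _; first by case: step.
rewrite /depT /desc /=.
by case: (u %/ B) => [|a] //=; case: (v %/ B).
Qed.

Lemma atTE k u : atT k (desc u) = enc_bool (at_depth k u).
Proof.
rewrite /atT /at_depth /desc /bdesc /kindT /depT /=; case: ifP => //= _.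
by rewrite eqlenTE !size_nseq.
Qed.

Lemma powTE s : powT (enc_seq s) = enc_posrat (pow2 (size s)).
Proof.
rewrite /powT unTE catTE cats1 -enc_nat_pow2 /enc_posrat /pow2 pmulrn numq_int.
by rewrite denq_int.
Qed.

Lemma entryTE u v : entryT l K x (desc u) (desc v) = entry u v.
Proof.
rewrite /entryT adjTE enc_boolE /entry; case: ifP => // _.
rewrite /weightT !atTE !enc_boolE vertsTE !catTE (powTE [::]) !powTE /wexp.
set s := map _ _; have sz : size s = l.+2 * B by rewrite size_map size_iota.
rewrite !size_cat size_nseq !sz.
do 2!(case: at_depth => //=); do 2!(case: at_depth => //=).
all: by congr (enc_posrat (pow2 _)); lia.
Qed.

Lemma graphTE : graphT l K x = enc_seq [seq enc_seq
  [seq entry u v | v <- iota 0 (l.+2 * B)] | u <- iota 0 (l.+2 * B)].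
Proof.
rewrite /graphT /entry_rowT vertsTE mapTE -map_comp; congr enc_seq.
apply: eq_map => u /=; rewrite mapTE -map_comp; congr enc_seq.
by apply: eq_map => v /=; rewrite entryTE.
Qed.

Lemma skipTE t k s : skipT x t (unary k) (enc_seq s) = nth Leaf s (t * B + n + k).
Proof.
have [r hx sz] := size_hd_x.
have -> : skipT x t (unary k) (enc_seq s) =
  hdT (dropT (unary k) (dropT (hdT x) (enc_seq (drop (t * B) s)))).
  rewrite /skipT; congr (hdT (dropT _ (dropT _ _))).
  elim: t => [|t IH] /=; first by rewrite drop0.
  by rewrite IH branchesTE dropTE size_branches drop_drop mulSn.
by rewrite hx dropTE sz hd_dropT size_nseq !nth_drop addnA.
Qed.

Lemma coverTE (f : nat -> nat -> bool) : 0 < l ->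
  coverT l (Node x (enc_seq [seq enc_seq
    [seq enc_bool (f u v) | v <- iota 0 (l.+2 * B)] | u <- iota 0 (l.+2 * B)])) =
  enc_seq [seq enc_bool (f (l.-1 * B + n + k) (l * B + n + k))
    | k <- iota 0 (size rows)].
Proof.
move=> l_gt0; rewrite /coverT /= unTE iotaTE mapTE -map_comp size_nseq size_map.
congr enc_seq; apply/eq_in_map => k; rewrite mem_iota add0n /= => kr.
have bnd t : t <= l -> t * B + n + k < l.+2 * B.
  move=> tl; rewrite -addnA; apply: (@leq_trans (t.+1 * B)).
    by rewrite mulSn addnC ltn_add2r /B ltn_add2l.
  by rewrite leq_mul2r; lia.
rewrite /bitT /= skipTE (nth_map 0) ?size_iota ?bnd //; last by lia.
rewrite skipTE nth_iota ?bnd //; last by lia.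
by rewrite (nth_map 0) ?size_iota ?bnd // nth_iota ?bnd.
Qed.

End Spec.

(** * Distances and chordality *)

Section Distance.

Variables (R : realType) (T : finType) (e : rel T).

(** Lower bounds on distances are handled as bounds on all walks; edges in different components are
    then far apart vacuously, with no infinite values. *)
Definition far_edges k (A B : {set T}) := forall u v p,
  u \in A -> v \in B -> path e u p -> last u p = v -> k <= size p.

Lemma edge_distP k A B :
  ((k%:R)%:E <= edge_dist R e A B)%E <-> far_edges k A B.
Proof.
rewrite /edge_dist; split=> [H u v p uA vB ep lp|H].
  move/bigmin_geP: H => [_ /(_ u uA)/bigmin_geP[_ /(_ v vB)/ereal_infP]].
  by move=> /(_ (size p)%:R%:E); rewrite lee_fin ler_nat; apply; exists p.
apply/bigmin_geP; split=> [|u uA]; first exact: leey.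
apply/bigmin_geP; split=> [|v vB]; first exact: leey.
by apply/ereal_infP => _ [p [ep lp] <-]; rewrite lee_fin ler_nat; apply: H lp.
Qed.

Definition far_matching k (M : {set {set T}}) := M \subset edges e /\
  forall A B, A \in M -> B \in M -> A != B -> far_edges k A B.

Lemma dist_matchingP k M : dist_matching R e k M <-> far_matching k M.
Proof.
by split=> -[ME H]; split=> // A B AM BM AB; apply/edge_distP; apply: H.
Qed.

Lemma edgesP A :
  reflect (exists u v, e u v /\ A = [set u; v]) (A \in edges e).
Proof.
apply: (iffP imset2P) => [[u v _]|[u [v [uv ->]]]].
  by rewrite inE => /andP[_ uv] ->; exists u, v.
by exists u v; rewrite ?inE.
Qed.

Hypothesis e_sym : symmetric e.

Lemma far_edges_sym k A B : far_edges k A B -> far_edges k B A.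
Proof.
move=> H u v p uB vA ep lp; rewrite -(size_belast u p) -size_rev.
case: p ep lp => [|w p] ep lp; first by apply: (H v u [::]); rewrite // -lp.
apply: (H v u) => //; last by rewrite /= rev_cons last_rcons.
by rewrite -lp rev_path; under eq_path => a b do rewrite e_sym.
Qed.

Lemma far_matching_setU1 k M A : far_matching k M -> A \in edges e ->
  (forall C, C \in M -> far_edges k A C) -> far_matching k (A |: M).
Proof.
move=> [ME MM] AE H; split=> [|C D].
  by apply/fintype.subsetP => C; rewrite !inE => /orP[/eqP->//|]; apply: (fintype.subsetP ME).
rewrite !inE => /orP[/eqP->|CM] /orP[/eqP->|DM]; rewrite ?eqxx // => CD.
- exact: H.
- exact/far_edges_sym/H.
- exact: MM.
Qed.

(** Upper bounds on distances, to be played against [far_edges] in [far_not_near]. *)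
Definition near d u v := exists p, [/\ path e u p, last u p = v & size p <= d].

Lemma near_refl u : near 0 u u.
Proof. by exists [::]. Qed.

Lemma near_edge u v : e u v -> near 1 u v.
Proof. by move=> uv; exists [:: v]; rewrite /= uv. Qed.

Lemma near_trans d1 d2 u v w : near d1 u v -> near d2 v w -> near (d1 + d2) u w.
Proof.
move=> [p [ep lp sp]] [q [eq lq sq]]; exists (p ++ q).
by rewrite cat_path last_cat size_cat lp ep eq leq_add.
Qed.

Lemma near_sym d u v : near d u v -> near d v u.
Proof.
move=> [p [ep lp sp]]; exists (rev (belast u p)); split.
- by rewrite -lp rev_path; under eq_path => a b do rewrite e_sym.
- by case: p {ep sp} lp => //= w p _; rewrite rev_cons last_rcons.
- by rewrite size_rev size_belast.
Qed.

Lemma near_le d d' u v : d <= d' -> near d u v -> near d' u v.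
Proof. by move=> dd' [p [? ? /leq_trans h]]; exists p; split=> //; apply: h. Qed.

Lemma far_not_near k d (A B : {set T}) u v : far_edges k A B ->
  u \in A -> v \in B -> near d u v -> k <= d.
Proof. by move=> H uA vB [p [ep lp]]; apply: leq_trans; apply: H lp. Qed.

(** Lower bounds on walk lengths come from potentials: one that rises by at most 1 per edge forces a
    walk to be as long as the total rise. *)
Lemma lipschitz_path (phi : T -> int) u p :
  (forall a b, e a b -> phi b <= phi a + 1)%R -> path e u p ->
  (phi (last u p) <= phi u + (size p)%:Z)%R.
Proof.
move=> H; elim: p u => [|v p IH] u /=; first by rewrite addr0.
by case/andP=> /H uv /IH; lia.
Qed.

End Distance.

(* Traversing the vertices in decreasing order is a perfect elimination
   scheme: in a cycle, the two neighbours of the largest vertex are joined. *)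
Lemma chordal_lower_clique N (e : rel 'I_N) : symmetric e ->
  (forall v x y : 'I_N, x < v -> y < v -> x != y -> e v x -> e v y -> e x y) ->
  irreflexive e -> chordal e.
Proof.
move=> e_sym H e_irr c uc sc.
have [v0 v0c] : exists v, v \in c by case: c sc {uc} => // v c; exists v; rewrite mem_head.
case: (arg_maxnP (fun v : 'I_N => val v) v0c) => v vc vmax.
have [i s def] := rot_to vc.
have : ucycle e (v :: s) by rewrite -def rot_ucycle.
have inc w : w \in v :: s -> w \in c by rewrite -def mem_rot.
have : 3 < size (v :: s) by rewrite -def size_rot.
have nextE w : next c w = next (v :: s) w by rewrite -def next_rot // (ucycle_uniq uc).
(* Rotated to start at its largest vertex v, the cycle reads v, y, z, ..., x; the chord joins x and
   y. *)
case: s def inc nextE => [|y [|z s]] // _; case/lastP: s => [|s x] // inc nextE _.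
set cc := v :: _ => /andP[cyc ucc].
have yc : y \in cc by rewrite !inE eqxx orbT.
have xc : x \in cc by rewrite !inE mem_rcons mem_head !orbT.
have vy : e v y by move: cyc => /= /andP[].
have xv : e x v.
  by move: cyc; rewrite /cc /= rcons_path last_rcons => /and3P[_ _ /andP[]].
have lt_v w : w \in cc -> e v w -> w < v.
  move=> /inc/vmax wv vw; rewrite ltn_neqAle; apply/andP; split=> //.
  by apply: contraTneq vw => /val_inj->; rewrite e_irr.
have [nxy nvx nvy nzx] : [/\ x != y, v != x, v != y & z != x].
  move: ucc; rewrite /cc /= !inE !mem_rcons !inE !negb_or.
  by case/and4P=> /and4P[? ? ? ?] /and3P[? ? ?] /andP[? ?] _; split=> //; rewrite eq_sym.
exists x, y; split; [exact: inc|exact: inc| | |].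
- by apply: (H v) => //; [apply: lt_v; rewrite // e_sym|apply: lt_v|rewrite e_sym].
- rewrite nextE (_ : next cc x = v) 1?eq_sym //.
  (* As x is last, [next_nth] looks past the end of the list and returns its default, the head v. *)
  have ix : index x cc = size (y :: z :: rcons s x).
    by rewrite -(index_last ucc) /= last_rcons.
  by rewrite next_nth xc ix /cc nth_default.
- rewrite nextE (_ : next cc y = z) 1?eq_sym //.
  by rewrite next_nth yc /cc /= (negbTE nvy) eqxx.
Qed.

(** * The graph of the reduction *)

Section Graph.

Variables (l n : nat) (rows : seq (seq bool)).
Hypothesis l_gt0 : 0 < l.
Let m := size rows.
Let B := n + m.
Hypothesis n_gt0 : 0 < n.

Definition nvert := l.+2 * (n + size rows).

Let B_gt0 : 0 < B. Proof. by rewrite /B addn_gt0 n_gt0. Qed.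

Definition branch (u : 'I_nvert) := u %% B.
Definition depth (u : 'I_nvert) := u %/ B.

Definition red_adj (u v : 'I_nvert) := vadj l n rows u v.

Lemma depth_lt u : depth u < l.+2.
Proof. by rewrite ltn_divLR. Qed.

Lemma branch_lt u : branch u < B.
Proof. exact: ltn_pmod. Qed.

Lemma vertexP t j : t < l.+2 -> j < B ->
  exists u : 'I_nvert, [/\ depth u = t, branch u = j & val u = t * B + j].
Proof.
move=> tl jB; have lt : t * B + j < nvert.
  apply: (@leq_trans (t.+1 * B)); first by rewrite mulSn addnC ltn_add2r.
  by rewrite leq_mul2r tl orbT.
exists (Ordinal lt); rewrite /depth /branch /=; split=> //.
  by rewrite divnMDl // divn_small // addn0.
by rewrite modnMDl modn_small.
Qed.

Lemma vertex_inj u v : depth u = depth v -> branch u = branch v -> u = v.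
Proof.
move=> ed eb; apply: val_inj => /=.
by rewrite (divn_eq u B) (divn_eq v B) -/(depth u) -/(branch u) ed eb.
Qed.

Lemma red_adjE u v : red_adj u v =
  if branch u == branch v then
    (depth v == (depth u).+1) && ((n <= branch u) || (depth u < l)) ||
    (depth u == (depth v).+1) && ((n <= branch v) || (depth v < l))
  else [&& depth u == 0, depth v == 0 & incident n rows (branch u) (branch v)].
Proof. by []. Qed.

Lemma incidentC j k : incident n rows j k = incident n rows k j.
Proof. by rewrite /incident; case: ifP; case: ifP. Qed.

Lemma red_adj_sym : symmetric red_adj.
Proof.
move=> u v; rewrite !red_adjE eq_sym incidentC; case: ifP => // _; first by rewrite orbC.
by rewrite andbCA.
Qed.

Lemma red_adj_irr : irreflexive red_adj.
Proof. by move=> u; rewrite red_adjE eqxx (ltn_eqF (ltnSn (depth u))). Qed.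

(** A smaller neighbour of v is either its predecessor on the same branch, which is unique and
    exists only at positive depth, or, when v is a base, the base of an element. Element bases form
    a clique. *)
Lemma red_adj_chordal : chordal red_adj.
Proof.
apply: chordal_lower_clique red_adj_sym _ red_adj_irr => v x y xv yv nxy.
have coord u : val u = depth u * B + branch u := divn_eq u B.
have lower (u : 'I_nvert) : u < v -> red_adj v u ->
    branch u = branch v /\ depth v = (depth u).+1 \/
    [/\ depth v = 0, depth u = 0, branch u < branch v, branch u < n
      & incident n rows (branch v) (branch u)].
  move=> uv; have dle : depth u <= depth v by rewrite leq_div2r // ltnW.
  rewrite red_adjE; case: eqP => [eb|/eqP nb].
    by case/orP=> /andP[/eqP ed _]; [lia|left].
  case/and3P=> /eqP dv /eqP du inc; right.
  have lt_b : branch u < branch v.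
    by move: uv; rewrite (coord u) (coord v) du dv.
  have un : branch u < n.
    move: inc; rewrite /incident; case: (leqP n (branch v)) => [_|h _].
      by case: leqP.
    exact: ltn_trans lt_b h.
  by split.
move=> /(lower _ xv) Hx /(lower _ yv) Hy.
case: Hx => [[bx dx]|[dv dx lx xn ix]]; case: Hy => [[by_ dy]|[dv' dy ly yn iy]].
- by case/eqP: nxy; apply: vertex_inj; lia.
- by lia.
- by lia.
have nb : branch x != branch y.
  by apply: contraNneq nxy => eb; apply/eqP/vertex_inj; rewrite ?dx ?dy.
by rewrite red_adjE (negbTE nb) dx dy /incident (leqNgt n) xn (leqNgt n) yn.
Qed.

(** Such a walk passes through the bases of both branches, and the crossing takes one edge, or two
    if the bases are not adjacent; [s] asks for the stronger bound. *)
Lemma far_branches (s : bool) u v p : branch u != branch v ->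
  (s -> ~~ incident n rows (branch u) (branch v)) ->
  path red_adj u p -> last u p = v -> depth u + depth v + 1 + s <= size p.
Proof.
move=> nb Hs ep lp.
(* The potential phi changes by at most 1 along an edge; the base vertices of the
   two branches have potentials -1 and s, and all other branches have 0. *)
pose phi (w : 'I_nvert) : int := if branch w == branch u then (- (depth w).+1%:Z)%R
  else if branch w == branch v then Posz (depth w + s) else 0%R.
have lip a b : red_adj a b -> (phi b <= phi a + 1)%R.
  rewrite red_adjE /phi; case: eqP => [->|nab].
    by case: ifP => _; [|case: ifP => _]; case/orP=> /andP[/eqP d _]; lia.
  case/and3P=> /eqP-> /eqP-> inc.
  case: (eqVneq (branch a) (branch u)) => au; case: (eqVneq (branch b) (branch u)) => bu.
  - by lia.
  - case: (eqVneq (branch b) (branch v)) => bv; last by lia.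
    case: s Hs {phi} => [/(_ isT)|]; last by lia.
    by rewrite -au -bv inc.
  - case: eqP => _; case: s {Hs phi}; rewrite ?add0n /=; lia.
  - case: eqP => _; case: eqP => _; case: s {Hs phi}; rewrite ?add0n /=; lia.
have := lipschitz_path lip ep; rewrite lp /phi eqxx eq_sym (negbTE nb) eqxx. by case: s {Hs lip phi} => /=; lia.
Qed.

Lemma near_up u v : branch u = branch v -> depth u <= depth v ->
  (n <= branch u) || (depth v <= l) -> near red_adj (depth v - depth u) u v.
Proof.
move=> eb le; move: {2}(depth v - depth u) (erefl (depth v - depth u)) => k.
elim: k v eb le => [|k IH] v eb le dk ok.
  have -> : u = v by apply: vertex_inj; lia.
  by apply: near_le (near_refl _ _).
have [w [dw bw _]] := vertexP (t := (depth v).-1) (j := branch v)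
  (leq_ltn_trans (leq_pred _) (depth_lt v)) (branch_lt v).
rewrite dk -addn1; apply: (@near_trans _ _ _ _ _ w).
  by have := IH w; rewrite dw bw => IHw; have <- : (depth v).-1 - depth u = k;
    [lia|apply: IHw; lia].
apply: near_edge; rewrite red_adjE bw eqxx dw; apply/orP; left.
by apply/andP; split; lia.
Qed.

Lemma near_branches u v : branch u != branch v -> incident n rows (branch u) (branch v) ->
  (n <= branch u) || (depth u <= l) -> (n <= branch v) || (depth v <= l) ->
  near red_adj (depth u + 1 + depth v) u v.
Proof.
move=> nb inc oku okv.
have [a [da ba _]] := vertexP (ltn0Sn l.+1) (branch_lt u).
have [b [db bb _]] := vertexP (ltn0Sn l.+1) (branch_lt v).
apply: (@near_trans _ _ _ _ _ b); last first.
  by have := @near_up b v; rewrite bb db subn0; apply.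
apply: (@near_trans _ _ _ _ _ a).
  apply: near_sym; first exact: red_adj_sym.
  by have := @near_up a u; rewrite ba da subn0; apply.
by apply: near_edge; rewrite red_adjE ba bb (negbTE nb) da db.
Qed.

(** In the notation of the overview, [seg l.-1 (n + k)] is e_k, [seg l (n + k)] is f_k, and
    [seg l.-1 x] with x < n is e_x. *)
Definition seg t j : {set 'I_nvert} :=
  [set u | (branch u == j) && ((depth u == t) || (depth u == t.+1))].

Lemma segP t j u : reflect (branch u = j /\ (depth u = t \/ depth u = t.+1)) (u \in seg t j).
Proof.
rewrite inE; apply: (iffP andP) => [[/eqP-> /orP[]/eqP->]|[-> H]]; first by split; [|left].
  by split; [|right].
by rewrite eqxx; split=> //; case: H => ->; rewrite eqxx ?orbT.
Qed.

Lemma seg_eq t j u v : depth u = t -> depth v = t.+1 -> branch u = j -> branch v = j ->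
  [set u; v] = seg t j.
Proof.
move=> du dv bu bv; apply/setP => w; rewrite !inE.
apply/orP/andP => [[]/eqP->|[/eqP bw /orP[]/eqP dw]].
- by rewrite bu du !eqxx.
- by rewrite bv dv !eqxx orbT.
- by left; apply/eqP/vertex_inj; congruence.
- by right; apply/eqP/vertex_inj; congruence.
Qed.

Lemma seg_edge t j : t <= l -> j < B -> (n <= j) || (t < l) -> seg t j \in edges red_adj.
Proof.
move=> tl jB ok; apply/edgesP.
have [u [du bu _]] := vertexP (leq_trans tl (leqnSn _) : t < l.+2) jB.
have [v [dv bv _]] := vertexP (tl : t.+1 < l.+2) jB.
exists u, v; rewrite (seg_eq du dv bu bv); split=> //.
by rewrite red_adjE bu bv du dv !eqxx ok.
Qed.

Lemma edge_cases A : A \in edges red_adj ->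
  (exists t j, [/\ j < B, t <= l, (n <= j) || (t < l) & A = seg t j]) \/
  (exists u v, [/\ A = [set u; v], depth u = 0, depth v = 0 & branch u < n]).
Proof.
case/edgesP=> u [v [uv ->]].
move: uv; rewrite red_adjE; case: eqP => [eb|nb].
  case/orP=> /andP[/eqP d ok]; left.
    exists (depth u), (branch u); rewrite branch_lt; split=> //.
      by have := depth_lt v; lia.
    by apply: seg_eq.
  exists (depth v), (branch v); rewrite branch_lt; split=> //.
    by have := depth_lt u; lia.
  by rewrite finset.setUC; apply: seg_eq.
case/and3P=> /eqP du /eqP dv inc; right.
case: (ltnP (branch u) n) => un; first by exists u, v.
exists v, u; split=> //; first by rewrite finset.setUC.
by move: inc; rewrite /incident un; case: ltnP.
Qed.

Definition light (A : {set 'I_nvert}) :=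
  [exists u in A, (n <= branch u) && ((depth u == l.+1) || (depth u == l))].

(** Since l > 0, no edge between bases reaches depth l, so the light edges are exactly edges of the
    form e_k or f_k. *)
Lemma light_edge A : A \in edges red_adj -> light A ->
  exists2 k, k < m & A = seg l.-1 (n + k) \/ A = seg l (n + k).
Proof.
move=> /edge_cases H /exists_inP[u uA /andP[nu du]].
case: H => [[t [j [jB tl ok def]]]|[a [b [def da db an]]]]; last first.
  by move: uA du; rewrite def !inE => /orP[]/eqP->; rewrite ?da ?db; lia.
move: uA; rewrite def => /segP[bu du']; exists (j - n).
  by move: jB; rewrite /B; lia.
have -> : n + (j - n) = j by lia.
have [->|->] : t = l.-1 \/ t = l by case: du' du => ->; lia.
  by left.
by right.
Qed.

(** Both ends have depth at least l - 1 and bases of sets are never adjacent, so the distance is at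
    least 2(l - 1) + 2. *)
Lemma segs_far t t' k k' : k < m -> k' < m -> l.-1 <= t -> l.-1 <= t' -> k != k' ->
  far_edges red_adj (2 * l) (seg t (n + k)) (seg t' (n + k')).
Proof.
move=> km k'm lt lt' nk u v p /segP[bu du] /segP[bv dv] ep lp.
have := @far_branches true u v p; rewrite bu bv eqn_add2l => /(_ nk) H.
apply: leq_trans (H _ ep lp); last by rewrite /incident !leq_addr.
by case: du => ->; case: dv => -> /=; lia.
Qed.

(** If no picked e_k belongs to a set containing x, then e_x is far from all of M. Maximality puts
    e_x into M, although e_x is not light. *)
Lemma cover_of_maximal (M : {set {set 'I_nvert}}) :
  far_matching red_adj (2 * l) M ->
  (forall M', far_matching red_adj (2 * l) M' -> M \subset M' -> M' = M) ->
  (forall A, A \in M -> light A) ->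
  forall x, x < n -> exists k, [/\ k < m, seg l.-1 (n + k) \in M & mem_row rows x k].
Proof.
move=> HM Mmax Ml x xn; apply: contrapT => noK.
have xB : x < B by rewrite /B ltn_addr.
have exE : seg l.-1 x \in edges red_adj by apply: seg_edge => //; lia.
suff far C : C \in M -> far_edges red_adj (2 * l) (seg l.-1 x) C.
  have := Mmax _ (far_matching_setU1 red_adj_sym HM exE far) (finset.subsetUr _ _).
  move=> eM; have : seg l.-1 x \in M by rewrite -eM !inE eqxx.
  by move/Ml/exists_inP=> [u /segP[-> _]]; lia.
move=> CM; have /(fintype.subsetP HM.1 _)/light_edge/(_ (Ml _ CM))[k km def] := CM.
move=> u v p /segP[bu du] vC ep lp.
have nb v' : branch v' = n + k -> branch u != branch v' by lia.
(* Against f_k, the bound (l - 1) + l + 1 holds whether or not x belongs to k; against e_k the extra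
   step of non-adjacent bases is used. *)
case: def vC => def; rewrite def => /segP[bv dv]; last first.
  have f0 : false -> ~~ incident n rows (branch u) (branch v) by [].
  have := far_branches (nb v bv) f0 ep lp.
  by case: du => ->; case: dv => -> /=; lia.
have nin : ~~ incident n rows (branch u) (branch v).
  rewrite bu bv /incident leqNgt xn leq_addr /= addKn.
  by apply/negP => xk; apply: noK; exists k; split=> //; rewrite -def.
have := @far_branches true u v p (nb v bv) (fun=> nin) ep lp.
by case: du => ->; case: dv => -> /=; lia.
Qed.

Definition choice_edge (c : nat -> bool) k := if c k then seg l.-1 (n + k) else seg l (n + k).

Definition cover_matching c : {set {set 'I_nvert}} := [set choice_edge c (val k) | k : 'I_m].

Lemma choice_edgeE c k : exists2 t, l.-1 <= t <= l & choice_edge c k = seg t (n + k).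
Proof.
by rewrite /choice_edge; case: ifP => _; [exists l.-1|exists l] => //; lia.
Qed.

Lemma cover_matching_far c : far_matching red_adj (2 * l) (cover_matching c).
Proof.
split=> [|A C /imsetP[k _ ->] /imsetP[k' _ ->]].
  apply/fintype.subsetP => _ /imsetP[k _ ->].
  have [t /andP[_ tl] ->] := choice_edgeE c k.
  by apply: seg_edge; rewrite ?ltn_add2l ?leq_addr.
move=> ne; have nk : val k != val k' by apply: contraNneq ne => ->.
have [t /andP[t1 _] ->] := choice_edgeE c k.
have [t' /andP[t1' _] ->] := choice_edgeE c k'.
exact: segs_far.
Qed.

(** Any further edge is too close to a chosen one. On a set branch, the chosen edge of that branch
    has a vertex at depth l, at distance at most l. Every other edge has a vertex on an element
    branch at depth below l. *)
Lemma cover_matching_max (c : nat -> bool) M' :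
  (forall x, x < n -> exists k, [/\ k < m, c k & mem_row rows x k]) ->
  far_matching red_adj (2 * l) M' -> cover_matching c \subset M' -> M' = cover_matching c.
Proof.
move=> cov [ME MM] sub; apply/eqP; rewrite finset.eqEsubset sub andbT.
apply/fintype.subsetP => A AM; apply: contraT => nA.
have far k : k < m -> far_edges red_adj (2 * l) A (choice_edge c k).
  move=> km; have kM : choice_edge c k \in cover_matching c.
    by apply/imsetP; exists (Ordinal km).
  apply: MM => //; first exact: (fintype.subsetP sub).
  by apply: contraNneq nA => ->.
(* Through the bases, such a vertex is within (l - 1) + 1 + (l - 1) = 2l - 1 of the e_k chosen for a
   set covering its element. *)
have elem u : u \in A -> branch u < n -> depth u < l -> False.
  move=> uA un ul; have [k [km ck xk]] := cov _ un.
  have kB : n + k < B by rewrite ltn_add2l.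
  have [v [dv bv _]] := vertexP (t := l.-1) (ltac:(lia) : l.-1 < l.+2) kB.
  have vC : v \in choice_edge c k.
    by rewrite /choice_edge ck; apply/segP; split=> //; left.
  have nb : branch u != branch v by lia.
  have nr := @near_branches u v nb.
  have := far_not_near (far k km) uA vC (nr _ _ _).
  have -> : incident n rows (branch u) (branch v).
    by rewrite bv /incident leqNgt un leq_addr /= addKn.
  by move=> /(_ isT) H; suff : 2 * l <= depth u + 1 + depth v; [lia|apply: H; lia].
have := fintype.subsetP ME _ AM; case/edge_cases => [[t [j [jB tl ok def]]]|].
  have [u [du bu _]] := vertexP (leq_trans tl (leqnSn _) : t < l.+2) jB.
  have uA : u \in A by rewrite def; apply/segP; split=> //; left.
  case: (ltnP j n) => jn; first by exfalso; apply: (elem u uA); lia.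
  have km : j - n < m by move: jB; rewrite /B; lia.
  have jE : n + (j - n) = j by lia.
  have [v [dv bv _]] := vertexP (ltnW (ltnSn l.+1) : l < l.+2) jB.
  have vC : v \in choice_edge c (j - n).
    by rewrite /choice_edge jE; case: ifP => _; apply/segP; split=> //; [right; lia|left].
  have nr : near red_adj (l - t) u v.
    by have := @near_up u v; rewrite bu bv du dv; apply => //; rewrite jn.
  by have := far_not_near (far _ km) uA vC nr; lia.
case=> u [v [def du dv un]]; exfalso; apply: (elem u) => //; last by rewrite du.
by rewrite def !inE eqxx.
Qed.

End Graph.

(** * Weights and the final estimate *)

(** The base case is a loop that is never entered, acting as the empty command at cost 1. *)
Fixpoint clear_cmd k :=
  if k is k'.+1 then Seq (Assign k ENil) (clear_cmd k') else While ENil (Assign 0 ENil).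

Lemma exec_clear k s :
  exec (clear_cmd k) s (2 * k).+1 (fun j => if 0 < j <= k then Leaf else s j).
Proof.
elim: k s => [|k IH] s.
  rewrite (_ : (fun _ => _) = s); first exact: ExecWhileDone.
  by apply/funext => -[|j].
have -> : (2 * k.+1).+1 = (tree_size Leaf).+1 + (2 * k).+1 by rewrite /=; lia.
apply: ExecSeq; first exact: ExecAssign.
have := IH (update s k.+1 Leaf); congr exec; apply/funext => j; rewrite /update /=.
case: (j =P k.+1) => [->|nj]; first by rewrite /= ltnn leqnn.
by have -> : (j <= k.+1) = (j <= k) by lia.
Qed.

(* The registers that a program leaves behind are erased at the end. *)
Lemma ptime_of_computes I (D : I -> Prop) (x y : I -> tree) C (p : {poly nat}) :
  (forall i, D i -> exists2 t, computes C (x i) t (y i) & t <= p.[tree_size (x i)]%R) ->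
  ptime D x y.
Proof.
move=> H; exists (Seq C (clear_cmd (vbound C))), (p + (2 * vbound C).+1%N%:P)%R => i Di.
have [t [s [r s0]] le] := H i Di.
exists (t + (2 * vbound C).+1); last by rewrite !horner_natE leq_add2r.
apply: ExecSeq; first exact: r.
have := exec_clear (vbound C) s; congr exec; apply/funext => -[|j].
  by rewrite /= s0 /st0 update_eq.
by rewrite /=; case: ltnP => // h; rewrite (exec_unchanged (k := j.+1) r (leqW h)).
Qed.

Lemma exists_minimum (R : realType) (U : finType) (P : U -> Prop) (f : U -> R) x :
  P x -> exists z, P z /\ forall w, P w -> (f z <= f w)%R.
Proof.
move=> Px; have Px' : `[< P x >] by apply/asboolP.
case: (@Order.TotalTheory.arg_minP _ _ _ x (fun z => `[< P z >]) f Px').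
move=> z /asboolP Pz zmin; exists z; split=> // w Pw.
by apply: zmin; apply/asboolP.
Qed.

(** [approx_min] compares only with minimizers; on a finite type one exists, which gives the
    comparison with every feasible solution. *)
Lemma approx_min_le (R : realType) (U : finType) (P : U -> Prop) (f : U -> R) beta y x :
  approx_min P f beta y -> P x -> (0 <= beta)%R -> (f y <= beta * f x)%R.
Proof.
move=> [_ H] Px b0; have [z [Pz zmin]] := exists_minimum f Px.
by apply: le_trans (H z Pz zmin) _; apply: ler_wpM2l => //; apply: zmin.
Qed.

Section Weights.

Variables (l K n : nat) (rows : seq (seq bool)).
Hypotheses (l_gt0 : 0 < l) (n_gt0 : 0 < n).

Let m := size rows.
Let N := nvert l n rows.
Let adjG : rel 'I_N := @red_adj l n rows.

(* K will be such that c <= 2^K, which makes a single heavy edge outweigh c ln N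
   times the total weight of any choice of cheap edges. *)
Definition set_exp (A : {set 'I_N}) :=
  if [exists u in A, at_depth n rows l.+1 u] then 0
  else if [exists u in A, at_depth n rows l u] then 2 * N else 4 * N + K.

Definition set_wt A := pow2 (set_exp A).

Lemma pow2_gt0 k : (0 < pow2 k)%R.
Proof. by rewrite /pow2 ltr0n expn_gt0. Qed.

Lemma exists_in_set2 (P : pred 'I_N) u v :
  [exists w in [set u; v], P w] = P u || P v.
Proof.
apply/exists_inP/orP => [[w]|[]Pw]; last 2 first.
- by exists u; rewrite ?inE ?eqxx.
- by exists v; rewrite ?inE ?eqxx ?orbT.
by rewrite !inE => /orP[]/eqP->; [left|right].
Qed.

Lemma set_exp2 u v : set_exp [set u; v] = wexp l K n rows u v.
Proof. by rewrite /set_exp !exists_in_set2. Qed.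

Definition red_graph : wgraph :=
  @WGraph N adjG (@red_adj_sym l n rows) (@red_adj_irr l n rows) set_wt
    (fun A _ => pow2_gt0 (set_exp A)).

Lemma enc_red_graph : enc_wgraph red_graph =
  enc_seq [seq enc_seq [seq entry l K n rows u v | v <- iota 0 N] | u <- iota 0 N].
Proof.
rewrite /enc_wgraph -val_enum_ord -map_comp; congr enc_seq.
apply: eq_map => u /=; rewrite -map_comp; congr enc_seq.
by apply: eq_map => v /=; rewrite /entry /set_wt set_exp2.
Qed.

Lemma set_exp_seg_set k : k < m -> set_exp (seg l n rows l.-1 (n + k)) = 2 * N.
Proof.
move=> km; rewrite /set_exp.
have -> : [exists u in seg l n rows l.-1 (n + k), at_depth n rows l.+1 u] = false.
  by apply/exists_inP => -[u /segP[_ du] /andP[_]]; rewrite -/(depth u); lia.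
have [||u [du bu _]] := @vertexP l n rows n_gt0 l (n + k); rewrite ?ltn_add2l //; try lia.
have -> // : [exists u in seg l n rows l.-1 (n + k), at_depth n rows l u].
apply/exists_inP; exists u; first by apply/segP; split=> //; right; lia.
by rewrite /at_depth -/(branch u) -/(depth u) bu du leq_addr eqxx.
Qed.

Lemma set_exp_seg_skip k : k < m -> set_exp (seg l n rows l (n + k)) = 0.
Proof.
move=> km; rewrite /set_exp.
have [||u [du bu _]] := @vertexP l n rows n_gt0 l.+1 (n + k); rewrite ?ltn_add2l //.
have -> // : [exists u in seg l n rows l (n + k), at_depth n rows l.+1 u].
apply/exists_inP; exists u; first by apply/segP; split=> //; right.
by rewrite /at_depth -/(branch u) -/(depth u) bu du leq_addr eqxx.
Qed.

Lemma set_exp_heavy A : ~~ light A -> set_exp A = 4 * N + K.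
Proof.
move=> /exists_inP nl; rewrite /set_exp.
case: exists_inP => [[u uA /andP[nu du]]|_].
  by case: nl; exists u => //; rewrite /branch nu /depth du.
case: exists_inP => [[u uA /andP[nu du]]|//].
by case: nl; exists u => //; rewrite /branch nu /depth du orbT.
Qed.

Lemma weight_light (M : {set {set 'I_N}}) :
  (@weight red_graph M < pow2 (4 * N + K))%R -> forall A, A \in M -> light A.
Proof.
move=> lt A AM; apply: contraTT lt => /set_exp_heavy hA.
rewrite -leNgt /weight (bigD1 A) //= /set_wt hA lerDl.
by apply: sumr_ge0 => C _; apply/ltW/pow2_gt0.
Qed.

Lemma seg_inj t k k' : t <= l -> k < m -> k' < m ->
  seg l n rows t (n + k) = seg l n rows t (n + k') -> k = k'.
Proof.
move=> tl km k'm E.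
have [||u [du bu _]] := @vertexP l n rows n_gt0 t (n + k); rewrite ?ltn_add2l //; try lia.
have : u \in seg l n rows t (n + k) by apply/segP; split=> //; left.
by rewrite E => /segP[+ _]; rewrite bu; lia.
Qed.

Lemma weight_ge (M : {set {set 'I_N}}) :
  (pow2 (2 * N) *+ #|[set k : 'I_m | seg l n rows l.-1 (n + k) \in M]| <=
    @weight red_graph M)%R.
Proof.
set S := [set _ | _]; pose g (k : 'I_m) := seg l n rows l.-1 (n + k).
have gM : g @: S \subset M.
  by apply/fintype.subsetP => _ /imsetP[k kS ->]; rewrite inE in kS.
rewrite /weight (big_setID (g @: S)) /= (finset.setIidPr gM).
apply: (@le_trans _ _ (\sum_(A in g @: S) set_wt A)%R); last first.
  by rewrite lerDl; apply: sumr_ge0 => C _; apply/ltW/pow2_gt0.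
rewrite big_imset /=; last first.
  by move=> k k' _ _ /seg_inj E; apply/val_inj/E => //; lia.
rewrite -sumr_const; apply: ler_sum => k _.
by rewrite /set_wt set_exp_seg_set.
Qed.

Lemma weight_cover_matching (c : nat -> bool) :
  (@weight red_graph (cover_matching l n rows c) <=
    pow2 (2 * N) *+ #|[set k : 'I_m | c k]| + m%:R)%R.
Proof.
rewrite /weight /cover_matching big_imset /=; last first.
  (* Distinct k give distinct chosen edges: e_k and f_k share the vertex at depth l, which
     determines the branch. *)
  move=> k k' _ _ E; apply: val_inj => /=.
  have [||u [du bu _]] := @vertexP l n rows n_gt0 l (n + k); rewrite ?ltn_add2l //.
  have : u \in choice_edge l n rows c k.
    by rewrite /choice_edge; case: ifP => _; apply/segP; split=> //; [right; lia|left].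
  by rewrite E /choice_edge; case: ifP => _ /segP[+ _]; rewrite bu; lia.
rewrite (bigID (fun k : 'I_m => c k)) /=; apply: lerD.
  rewrite -sumr_const [leRHS](eq_bigl (fun k : 'I_m => c k)); last by move=> k; rewrite inE.
  by apply: ler_sum => k ck; rewrite /set_wt /choice_edge ck set_exp_seg_set.
apply: (@le_trans _ _ (\sum_(k < m) 1)%R); last by rewrite sumr_const card_ord.
rewrite [leRHS](bigID (fun k : 'I_m => c k)) /= -[leLHS]add0r; apply: lerD.
  exact: sumr_ge0.
by apply: ler_sum => k /negbTE ck; rewrite /set_wt /choice_edge ck set_exp_seg_skip.
Qed.

End Weights.

(** * Numerical estimates *)

Lemma heavy_bound_nat N m : 0 < N -> m <= N -> N * (2 ^ (2 * N) * m + m) < 2 ^ (4 * N).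
Proof.
move=> N0 mN; have lt2 : N < 2 ^ N by apply: ltn_expl.
have -> : 2 ^ (4 * N) = 2 ^ (2 * N) * 2 ^ (2 * N) by rewrite -expnD; congr (_ ^ _); lia.
have -> : 2 ^ (2 * N) = 2 ^ N * 2 ^ N by rewrite -expnD; congr (_ ^ _); lia.
move: (2 ^ N) lt2 => e lt2.
have h : N * m < e * e by apply: leq_ltn_trans (_ : N * N < _); nia.
(* With E = 2^(2N) and N m <= E - 1, the left side N m (E + 1) is at most E^2 - 1. *)
move: (e * e) h => E h; nia.
Qed.

Lemma slack_bound_nat N m : 0 < N -> m <= N -> 2 * (m * N) <= 2 ^ (2 * N).
Proof.
move=> N0 mN; have lt2 : N.-1 < 2 ^ N.-1 by apply: ltn_expl.
have -> : 2 ^ (2 * N) = 4 * (2 ^ N.-1 * 2 ^ N.-1).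
  by rewrite -expnD -[4]/(2 ^ 2) -expnD; congr (_ ^ _); lia.
move: (2 ^ _) lt2 => e lt2; nia.
Qed.

Section Numeric.

Local Open Scope ring_scope.

Variable R : realType.

(** The inequality ln(1 + x) <= x at x = -1/2. *)
Lemma ln2_ge_half : 2^-1 <= ln (2 : R).
Proof.
have := @le_ln1Dx R (- 2^-1); have -> : 1 - 2^-1 = 2^-1 :> R by field.
by rewrite lnV ?posrE // lerN2; apply; lra.
Qed.

Lemma ln_nat_le n : (0 < n)%N -> ln (n%:R : R) <= n%:R.
Proof.
move=> n0; have := @le_ln1Dx R (n%:R - 1).
have -> : 1 + (n%:R - 1) = n%:R :> R by ring.
have : 1 <= n%:R :> R by rewrite ler1n.
by move=> n1 H; apply: le_trans (H _) _; lra.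
Qed.

(** The left side bounds the weight of an approximate solution, the right side is the weight of one
    heavy edge. It suffices to estimate c by 2^K and ln N by N. *)
Lemma heavy_bound (c : R) K N m k : 0 <= c -> c <= (2 ^ K)%N%:R -> (0 < N)%N ->
  (m <= N)%N -> (k <= m)%N ->
  c * ln N%:R * ((2 ^ (2 * N))%N%:R * k%:R + m%:R) < (2 ^ (4 * N + K))%N%:R.
Proof.
move=> c0 cK N0 mN km.
have lnN : 0 <= ln (N%:R : R) by apply: ln_ge0; rewrite ler1n.
have w0 : 0 <= (2 ^ (2 * N))%N%:R * k%:R + m%:R :> R by rewrite -natrM -natrD ler0n.
have w1 : (2 ^ (2 * N))%N%:R * k%:R + m%:R <= (2 ^ (2 * N) * m + m)%N%:R :> R.
  by rewrite -natrM -natrD ler_nat leq_add2r leq_mul2l km orbT.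
apply: (@le_lt_trans _ _ ((2 ^ K)%N%:R * (N * (2 ^ (2 * N) * m + m))%N%:R)).
  rewrite -mulrA; apply: ler_pM cK _ => //; first exact: mulr_ge0.
  by rewrite natrM; apply: ler_pM (ln_nat_le N0) w1.
by rewrite -natrM ltr_nat expnD mulnC ltn_mul2r expn_gt0 heavy_bound_nat.
Qed.

(** From 2N <= n^d follows ln N + ln 2 <= d ln n. With E = 2^(2N), the resulting slack E k ln 2 is
    at least E / 2, which exceeds or equals m N and so absorbs the error term m ln N. *)
Lemma ratio_bound (c : R) n d N m k q : 0 <= c -> (1 < n)%N -> (0 < N)%N ->
  (m <= N)%N -> (2 * N <= n ^ d)%N -> (0 < k)%N ->
  (2 ^ (2 * N))%N%:R * q <= c * ln N%:R * ((2 ^ (2 * N))%N%:R * k%:R + m%:R) ->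
  q <= c * d%:R * ln n%:R * k%:R.
Proof.
move=> c0 n1 N0 mN Nn k0 H.
have n0 : (0 < n)%N by apply: ltnW.
set E : R := (2 ^ (2 * N))%N%:R in H *.
have E0 : 0 < E by rewrite ltr0n expn_gt0.
rewrite -(ler_pM2l E0); apply: le_trans H _.
have -> : E * (c * d%:R * ln n%:R * k%:R) = c * (E * k%:R * (d%:R * ln n%:R)) by ring.
rewrite -mulrA; apply: ler_wpM2l => //.
have lnD : ln N%:R + ln 2 <= d%:R * ln n%:R :> R.
  rewrite [leRHS]mulr_natl -lnXn ?ltr0n // addrC -lnM ?posrE ?ltr0n //.
  by rewrite ler_ln ?posrE ?mulr_gt0 ?exprn_gt0 ?ltr0n // -natrM -natrX ler_nat.
have k1 : 1 <= k%:R :> R by rewrite ler1n.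
apply: (@le_trans _ _ (E * k%:R * (ln N%:R + ln 2))); last first.
  by apply: ler_wpM2l lnD; rewrite mulr_ge0 ?ler0n // ltW.
have mL : m%:R * ln N%:R <= E * ln 2.
  apply: (@le_trans _ _ (m%:R * N%:R)); first by rewrite ler_wpM2l ?ln_nat_le.
  apply: (@le_trans _ _ (E * 2^-1)); last by rewrite ler_pM2l // ln2_ge_half.
  rewrite ler_pdivlMr // -!natrM ler_nat mulnC; exact: slack_bound_nat.
have : E * ln 2 <= E * k%:R * ln 2.
  rewrite -subr_ge0 (_ : _ - _ = (E * ln 2) * (k%:R - 1)); last by ring.
  rewrite mulr_ge0 ?subr_ge0 // mulr_ge0 ?ltW //.
  by apply: lt_le_trans ln2_ge_half; rewrite invr_gt0.
have -> : E * k%:R * (ln N%:R + ln 2) = E * k%:R * ln N%:R + E * k%:R * ln 2 by ring.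
have -> : ln N%:R * (E * k%:R + m%:R) = E * k%:R * ln N%:R + m%:R * ln N%:R :> R by ring.
by move=> h; rewrite lerD2l; apply: le_trans mL h.
Qed.

End Numeric.

(** * From matchings back to set covers *)

Section Instance.

Variable I : set_cover_instance.
Let n := univ I.
Let m := size (sets I).

Definition rows_of : seq (seq bool) :=
  [seq [seq x \in A | x <- enum 'I_(univ I)] | A : {set 'I_(univ I)} <- sets I].

Lemma enc_instanceE : enc_set_cover_instance I =
  enc_seq [seq enc_seq (map enc_bool r) | r <- rows_of].
Proof.
rewrite /enc_set_cover_instance /rows_of -map_comp; congr enc_seq.
by apply: eq_map => A /=; rewrite -map_comp.
Qed.

Lemma size_rows_of : size rows_of = m.
Proof. by rewrite size_map. Qed.

Hypothesis n_gt0 : 0 < n.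

(** A nonempty universe cannot be the union of an empty collection, so there is a first row, from
    which n can be read off. *)
Lemma size_head_rows_of : size (head [::] rows_of) = n.
Proof.
rewrite /rows_of; have := sets_feasible I; case: (sets I) => [|A s] /=.
  by rewrite big_nil => /setP/(_ (Ordinal n_gt0)); rewrite !inE.
by move=> _; rewrite size_map size_enum_ord.
Qed.

Lemma mem_rows_of (x : 'I_n) k : k < m ->
  mem_row rows_of x k = (x \in nth finset.set0 (sets I) k).
Proof.
move=> km; rewrite /mem_row (nth_map finset.set0) // (nth_map x) ?size_enum_ord //.
by rewrite nth_ord_enum.
Qed.

Variables (l K : nat).
Hypothesis l_gt0 : 0 < l.

Let rows := rows_of.
Let N := nvert l n rows.
Let G := red_graph l K n rows.

Definition cover_of (M : {set {set 'I_N}}) : {set {set 'I_n}} :=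
  [set A in sets I | seg l n rows l.-1 (n + index A (sets I)) \in M].

Lemma enc_cover_of (M : {set {set 'I_N}}) :
  coverT l (Node (enc_set_cover_instance I) (@enc_edge_set G M)) =
  @enc_subcollection I (cover_of M).
Proof.
(* [coverTE] speaks of matrices indexed by naturals; [f] extends membership in M by false outside
   the vertex range. *)
pose f u v := [exists i : 'I_N, exists j : 'I_N,
  [&& val i == u, val j == v & [set i; j] \in M]].
have fE (i j : 'I_N) : f (val i) (val j) = ([set i; j] \in M).
  apply/existsP/idP => [[i' /existsP[j' /and3P[/eqP/val_inj-> /eqP/val_inj-> //]]]|ij].
  by exists i; apply/existsP; exists j; rewrite !eqxx.
have -> : @enc_edge_set G M =
    enc_seq [seq enc_seq [seq enc_bool (f u v) | v <- iota 0 N] | u <- iota 0 N].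
  rewrite /enc_edge_set /G /= -/N -val_enum_ord -map_comp; congr enc_seq.
  apply: eq_map => i /=; rewrite -map_comp; congr enc_seq.
  by apply: eq_map => j /=; rewrite fE.
rewrite enc_instanceE (coverTE size_head_rows_of) // size_rows_of /enc_subcollection.
congr enc_seq; rewrite -[in RHS](mkseq_nth finset.set0 (sets I)) /mkseq -map_comp.
apply/eq_in_map => k; rewrite mem_iota add0n /= => km; congr enc_bool.
have kB : n + k < n + size rows by rewrite size_rows_of ltn_add2l.
have [|u [du bu vu]] := @vertexP l n rows n_gt0 l.-1 (n + k) _ kB; first by lia.
have [|v [dv bv vv]] := @vertexP l n rows n_gt0 l (n + k) _ kB; first by lia.
rewrite size_rows_of in vu vv; rewrite -!addnA -vu -vv fE inE mem_nth // index_uniq ?sets_uniq //=.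
by rewrite (@seg_eq l n rows l.-1 (n + k)) //; lia.
Qed.

Lemma card_cover_of (M : {set {set 'I_N}}) :
  #|cover_of M| <= #|[set k : 'I_(size rows) | seg l n rows l.-1 (n + k) \in M]|.
Proof.
set S := [set k | _].
apply: leq_trans (leq_imset_card (fun k : 'I_(size rows) => nth finset.set0 (sets I) k) S).
apply/subset_leq_card/fintype.subsetP => A; rewrite inE => /andP[AI AM].
have km : index A (sets I) < size rows by rewrite size_rows_of index_mem.
by apply/imsetP; exists (Ordinal km); rewrite ?inE //= nth_index.
Qed.

Lemma cover_of_approx (R : realType) (c : rat) (d : nat) M :
  1 < n -> (0 <= c)%R -> (c <= (2 ^ K)%N%:R)%R ->
  0 < d -> m <= n ^ d -> 4 * l.+2 < n ->
  approx_min (maximal_dist_matching R (@adj G) (2 * l))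
    (fun M => ratr (weight M) : R)%R (ratr c * ln (nverts G)%:R)%R M ->
  approx_min (@is_set_cover I) (fun C => #|C|%:R : R)%R
    (ratr c * (d + 1)%:R * ln n%:R)%R (cover_of M).
Proof.
move=> n_gt1 c_ge0 cK d_gt0 md n_big H.
have N_gt0 : 0 < N by rewrite muln_gt0 addn_gt0 n_gt0.
have mN : m <= N by rewrite /N /nvert size_rows_of; nia.
(* Here n + m <= 2 n^d, hence 2N <= 4(l + 2) n^d <= n * n^d. *)
have N_le : 2 * N <= n ^ (d + 1).
  have nd : n <= n ^ d.
    by case: (d) d_gt0 => // d' _; rewrite expnS leq_pmulr // expn_gt0 n_gt0.
  by rewrite addn1 expnS /N /nvert size_rows_of -/m; nia.
have cR : (0 <= ratr c :> R)%R by rewrite ler0q.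
have lnN : (0 <= ln (N%:R : R))%R by apply: ln_ge0; rewrite ler1n.
(* Every cover yields a maximal matching, whose weight bounds that of M up to the ratio; k0 counts
   the edges e_k it picks. *)
have cov_bound C0 : @is_set_cover I C0 ->
    exists k0, [/\ 0 < k0, k0 <= m, k0 <= #|C0| &
      (ratr (@weight G M) <=
        ratr c * ln N%:R * ((2 ^ (2 * N))%N%:R * k0%:R + m%:R) :> R)%R].
  move=> [C0s C0c]; pose ch k := nth finset.set0 (sets I) k \in C0.
  have chP x : x < n -> exists k, [/\ k < size rows, ch k & mem_row rows x k].
    move=> xn; have : Ordinal xn \in finset.cover C0 by rewrite C0c inE.
    case/bigcupP=> A AC xA; have AI := C0s _ AC.
    exists (index A (sets I)); rewrite size_rows_of index_mem /ch nth_index //; split=> //.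
    by rewrite (@mem_rows_of (Ordinal xn)) ?index_mem // nth_index.
  exists #|[set k : 'I_(size rows) | ch k]|; split.
  - have [k [km ck _]] := chP 0 n_gt0.
    by apply/card_gt0P; exists (Ordinal km); rewrite inE.
  - by apply: leq_trans (max_card _) _; rewrite card_ord size_rows_of.
  - rewrite -(card_in_imset (f := fun k : 'I_(size rows) => nth finset.set0 (sets I) k)).
      by apply/subset_leq_card/fintype.subsetP => A /imsetP[k +  ->]; rewrite inE.
    have sz (k : 'I_(size rows)) : k < size (sets I).
      by rewrite -[size (sets I)]size_rows_of.
    move=> k k' _ _ /eqP; rewrite nth_uniq ?sets_uniq ?sz //.
    by move/eqP/val_inj.
  have P0 : maximal_dist_matching R (@adj G) (2 * l) (cover_matching l n rows ch).
    split; first exact/dist_matchingP/cover_matching_far.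
    by move=> M' /dist_matchingP; apply: cover_matching_max.
  apply: le_trans (approx_min_le H P0 _) _; first exact: mulr_ge0.
  apply: ler_wpM2l; first exact: mulr_ge0.
  have := @weight_cover_matching l K n rows l_gt0 n_gt0 ch.
  rewrite -(ler_rat R) => /le_trans; apply.
  by rewrite rmorphD /= -[(_ *+ #|_|)%R]mulr_natr /pow2 rmorphM /= !ratr_nat size_rows_of.
have [[dM Mmax] _] := H; move/dist_matchingP: (dM) => fM.
(* Applied to the whole collection, the bound leaves M no room for a heavy edge. *)
have Mlight A : A \in M -> light A.
  apply: (@weight_light l K n rows).
  have full : @is_set_cover I [set A in sets I].
    split=> [C|]; first by rewrite inE.
    apply/setP => x; rewrite -(sets_feasible I) finset.bigcup_seq.
    by apply/bigcupP/bigcupP => -[C CI xC]; exists C => //; move: CI; rewrite inE.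
  have [k0 [k0_gt0 k0m _ le_w]] := cov_bound _ full.
  rewrite -(ltr_rat R); apply: le_lt_trans le_w _.
  rewrite /pow2 ratr_nat; apply: heavy_bound => //.
  by rewrite -(ratr_nat R) ler_rat.
split.
  split=> [A|]; first by rewrite inE => /andP[].
  apply/setP => x; rewrite inE; apply/bigcupP.
  have [|k [km kM xk]] := cover_of_maximal l_gt0 n_gt0 fM _ Mlight (ltn_ord x).
    by move=> M' fM'; apply: Mmax; apply/dist_matchingP.
  rewrite size_rows_of in km; exists (nth finset.set0 (sets I) k).
    by rewrite inE mem_nth // index_uniq ?sets_uniq.
  by rewrite -mem_rows_of.
move=> C0 C0c _; have [k0 [k0_gt0 _ k0C le_w]] := cov_bound _ C0c.
apply: (@le_trans _ _ (ratr c * (d + 1)%:R * ln n%:R * k0%:R)%R); last first.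
  apply: ler_wpM2l; last by rewrite ler_nat.
  by apply: mulr_ge0; [apply: mulr_ge0 => //; exact: ler0n|apply: ln_ge0; rewrite ler1n].
(* What remains is that M weighs at least 2^(2N) for each set of the extracted cover. *)
apply: (ratio_bound cR n_gt1 N_gt0 mN N_le k0_gt0); apply: le_trans le_w.
have := @weight_ge l K n rows l_gt0 n_gt0 M; rewrite -(ler_rat R) => /(le_trans _); apply.
rewrite -[(pow2 _ *+ _)%R]mulr_natr /pow2 rmorphM /= !ratr_nat ler_wpM2l ?ler0n // ler_nat.
exact: card_cover_of.
Qed.

End Instance.

(* The approximation hypothesis on this graph gives c ln 2 >= 1, so that c > 0
   and the claimed ratio is at least 1. *)
Definition single_edge_graph : wgraph.
Proof.
apply: (@WGraph 2 (fun i j => i != j) _ _ (fun=> 1%R)) => //.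
- by move=> i j; rewrite eq_sym.
- by move=> i; rewrite eqxx.
Defined.

(** The empty matching is not maximal, so the minimum weight is positive and can be cancelled from
    optimum <= weight of M <= beta * optimum. *)
Lemma approx_ratio_ge1 (R : realType) k (beta : R) M :
  approx_min (maximal_dist_matching R (@adj single_edge_graph) k)
    (fun M => ratr (weight M) : R)%R beta M -> (1 <= beta)%R.
Proof.
move=> [PM H]; have [z [Pz zmin]] := exists_minimum (fun M => ratr (weight M) : R)%R PM.
have z0 : z != finset.set0.
  apply/eqP => z0; pose A : {set 'I_2} := [set ord0; ord_max].
  have /Pz.2 : dist_matching R (@adj single_edge_graph) k [set A].
    apply/dist_matchingP; split=> [|C D].
      by apply/fintype.subsetP => C /set1P->; apply/edgesP; exists ord0, ord_max.
    by move=> /set1P-> /set1P->; rewrite eqxx.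
  rewrite z0 finset.sub0set => /(_ isT)/setP/(_ A).
  by rewrite !inE eqxx.
have w0 : (0 < ratr (@weight single_edge_graph z) :> R)%R.
  by rewrite ltr0q /weight /= sumr_const ltr0n card_gt0.
rewrite -(ler_pM2r w0) mul1r; apply: le_trans (zmin _ PM) _.
exact: H.
Qed.

Lemma single_edge_graph_chordal : chordal (@adj single_edge_graph).
Proof.
move=> c /ucycle_uniq/card_uniqP <-.
have le2 : #|c| <= 2 by apply: leq_trans (max_card _) _; rewrite card_ord.
by rewrite ltnNge (leq_trans le2).
Qed.

(** * Codes of instances and optimal covers *)

Lemma enc_instance_inj I I' : 0 < univ I -> 0 < univ I' ->
  enc_set_cover_instance I = enc_set_cover_instance I' -> I = I'.
Proof.
move=> n0 n0'; rewrite !enc_instanceE => /(can_inj enc_seqK)/inj_map E.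
have {E} E : rows_of I = rows_of I'.
  apply: E => r r' /(can_inj enc_seqK)/inj_map; apply.
  by move=> [] [].
have := size_head_rows_of n0; rewrite E size_head_rows_of //.
case: I I' E {n0 n0'} => n s us fs [n' s' us' fs'] /= E nn'; subst n'.
have ss' : s = s'.
  move: E; rewrite /rows_of /=; apply: inj_map => A A' eA; apply/setP => x.
  have : x \in enum 'I_n by rewrite mem_enum.
  by move: x; apply/eq_in_map.
by subst s'; rewrite (Prop_irrelevance us us') (Prop_irrelevance fs fs').
Qed.

Lemma tree_size_instance I k : 0 < univ I -> univ I <= k ->
  tree_size (enc_set_cover_instance I) <= size (sets I) * (4 * k + 2) + 1.
Proof.
move=> n0 nk; rewrite /enc_set_cover_instance.
(* A bit has size at most 3 and its list cell adds 1. *)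
have row_le (A : {set 'I_(univ I)}) s :
    tree_size (enc_seq [seq enc_bool (x \in A) | x <- s]) <= 4 * size s + 1.
  by elim: s => //= x s IH; case: (x \in A) => /=; lia.
elim: (sets I) => //= A s IH; have := row_le A (enum 'I_(univ I)).
rewrite size_enum_ord mulSn => rA.
have sum_le a b X : a <= 4 * univ I + 1 -> b <= X + 1 -> a + b < 4 * k + 2 + X + 1.
  by lia.
exact: sum_le rA IH.
Qed.

Definition good_output (R : realType) (beta : R) I z :=
  exists C, z = @enc_subcollection I C /\
    approx_min (@is_set_cover I) (fun C => #|C|%:R : R)%R beta C.

(** An optimal cover exists, as the whole collection is a cover, and it is good enough once the
    ratio is at least 1. *)
Lemma good_output_exists (R : realType) (beta : R) I :
  (1 <= beta)%R -> exists z, good_output beta I z.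
Proof.
move=> b1.
have full : @is_set_cover I [set A in sets I].
  split=> [C|]; first by rewrite inE.
  apply/setP => x; rewrite -(sets_feasible I) finset.bigcup_seq.
  by apply/bigcupP/bigcupP => -[C CI xC]; exists C => //; move: CI; rewrite inE.
have [C [CC Cmin]] := exists_minimum (fun C : {set {set 'I_(univ I)}} => #|C|%:R : R)%R full.
exists (enc_subcollection C), C; split=> //; split=> // C0 C0c _.
by apply: le_trans (Cmin _ C0c) _; rewrite ler_peMl ?ler0n.
Qed.

(** * The set cover algorithm *)

Section Reduction.

Local Open Scope ring_scope.

Variables (R : realType) (l : nat) (c : rat) (l_gt0 : (0 < l)%N).
Hypothesis alg : poly_time_algorithm
       (fun G : wgraph => chordal (@adj G))
       enc_wgraph enc_edge_set
       (fun G => approx_min (maximal_dist_matching R (@adj G) (2 * l)%N)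
                            (fun M => ratr (weight M) : R)
                            (ratr c * ln (nverts G)%:R)).
Variables (d : nat) (d_gt1 : (1 < d)%N).

Let dom I := (1 < univ I)%N /\ (size (sets I) <= univ I ^ d)%N.
Let J := {I : set_cover_instance | dom I}.
Let x (j : J) := enc_set_cover_instance (sval j).
Let beta I : R := ratr c * (d + 1)%:R * ln (univ I)%:R.
Let big (j : J) := (4 * l.+2 < univ (sval j))%N.

Lemma ratio_ln2_ge1 : 1 <= ratr c * ln 2 :> R.
Proof.
have [C [p H]] := alg; have [M [t [_ _]]] := H _ single_edge_graph_chordal.
exact: approx_ratio_ge1.
Qed.

Lemma ratio_gt0 : 0 < c.
Proof.
rewrite -(ltr0q R) ltNge; apply/negP => c_le0.
have := ratio_ln2_ge1; apply/negP; rewrite -ltNge; apply: le_lt_trans ltr01.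
by rewrite mulr_le0_ge0 // ln_ge0 // ler1n.
Qed.

Lemma beta_ge1 (j : J) : 1 <= beta (sval j).
Proof.
have [n1 _] := svalP j; have cR : 0 <= ratr c :> R by rewrite ler0q ltW ?ratio_gt0.
apply: le_trans ratio_ln2_ge1 _; rewrite /beta.
have l2 : ln (2 : R) <= ln (univ (sval j))%:R.
  by rewrite ler_ln ?posrE ?ltr0n ?ler_nat // ltnW.
have l0 : 0 <= ln (2 : R) by apply: ln_ge0; rewrite ler1n.
rewrite -mulrA; apply: ler_wpM2l => //; apply: le_trans (l2) _.
by apply: ler_peMl; [exact: le_trans l0 l2|rewrite ler1n addn1].
Qed.

Lemma ptime_large : exists z, ptime big x z /\
  forall j, big j -> good_output (beta (sval j)) (sval j) (z j).
Proof.
have [C [p H]] := alg.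
have [K cK] : exists K, c <= (2 ^ K)%N%:R.
  exists (Num.bound c); apply: ltW; apply: lt_le_trans (archi_boundP (ltW ratio_gt0)) _.
  by rewrite ler_nat ltnW // ltn_expl.
pose G (j : J) := red_graph l K (univ (sval j)) (rows_of (sval j)).
have n0 (j : J) : (0 < univ (sval j))%N by have [n1 _] := svalP j; apply: ltnW.
(* The hypothesis provides some output for each graph; choice makes it a function of the instance,
   as [ptime] expects. *)
have /choice[y Hy] (j : J) : exists y, exists (M : {set {set 'I_(nverts (G j))}}) t,
    [/\ y = enc_edge_set M, computes C (enc_wgraph (G j)) t y,
      (t <= p.[tree_size (enc_wgraph (G j))])%N &
      approx_min (maximal_dist_matching R (@adj (G j)) (2 * l)%N)
        (fun M => ratr (weight M) : R) (ratr c * ln (nverts (G j))%:R) M].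
  have [M [t [? ? ?]]] := H (G j) (red_adj_chordal l_gt0 (n0 j)).
  by exists (enc_edge_set M), M, t.
have Py : ptime (fun=> True) x y.
  apply: (@ptime_comp _ _ _ (fun j => enc_wgraph (G j))); last first.
    apply: (@ptime_of_computes _ _ _ _ C p) => j _.
    by have [M [t [_ ? ? _]]] := Hy j; exists t.
  apply: (@ptime_ext _ _ _ (fun j => graphT l K (x j))) => [j _|].
    by rewrite /x enc_instanceE (graphTE _ _ (size_head_rows_of (n0 j))) enc_red_graph.
  exact/ptime_graph/ptime_id.
exists (fun j => coverT l (Node (x j) (y j))); split.
  by apply: ptime_sub (ptime_cover l (ptime_node (ptime_id _ _) Py)).
move=> j jbig; have [M [t [-> _ _ spec]]] := Hy j.
have [n1 md] := svalP j.
exists (@cover_of (sval j) l M); split; first exact: (enc_cover_of (n0 j) K l_gt0).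
by apply: (cover_of_approx (n0 j) l_gt0) spec => //; [exact: ltW ratio_gt0|exact: ltnW].
Qed.

(** If n <= 4(l + 2), then |S| <= n^d bounds the size of the code, and a table of good covers does
    it. Injectivity of the encoding makes the table well defined. *)
Lemma ptime_small : exists z, ptime (fun j => ~ big j) x z /\
  forall j, good_output (beta (sval j)) (sval j) (z j).
Proof.
have /choice[z Hz] (j : J) : exists z, good_output (beta (sval j)) (sval j) z.
  exact/good_output_exists/beta_ge1.
exists z; split=> //.
apply: (@ptime_finite _ _ _ _ ((4 * l.+2) ^ d * (4 * (4 * l.+2) + 2) + 1)).
  move=> j /negP; rewrite -leqNgt => nl; have [n1 md] := svalP j.
  apply: leq_trans (tree_size_instance (ltnW n1) nl) _.
  by rewrite leq_add2r leq_mul2r (leq_trans md) ?orbT // leq_exp2r // ltnW.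
move=> [I [n1 md]] [I' [n1' md']] _ _; rewrite /x /= => /enc_instance_inj E.
have {E} E : I = I' by apply: E; apply: ltnW.
by subst I'; congr z; congr exist; apply: Prop_irrelevance.
Qed.

Lemma ptime_approx : exists z, ptime (fun=> True) x z /\
  forall j, good_output (beta (sval j)) (sval j) (z j).
Proof.
have [zl [Pl Hl]] := ptime_large; have [zs [Ps Hs]] := ptime_small.
exists (fun j => if big j then zl j else zs j); split; last first.
  by move=> j; case: ifP => // /Hl.
(* The program decides whether n > 4(l + 2) by dropping that many entries from the first row and
   testing whether any remain. *)
pose b j := dropT (unary (4 * l.+2)) (hdT (x j)).
have bP j : (big j -> b j <> Leaf) /\ (~~ big j -> b j = Leaf).
  have n0 : (0 < univ (sval j))%N by have [n1 _] := svalP j; apply: ltnW.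
  rewrite /b /x enc_instanceE.
  have [s -> sz] := size_hd_x (size_head_rows_of n0).
  rewrite dropTE size_nseq /big -sz -leqNgt; split=> [lt|le].
    by rewrite (drop_nth Leaf lt).
  by rewrite drop_oversize.
apply: (@ptime_cases _ _ _ b).
- by rewrite /b; pt.
- apply: (@ptime_ext _ _ _ zl) => [j [_ nb]|].
    by case: ifP => // /negbT/(bP j).2.
  apply: ptime_sub Pl => j [_ nb]; apply: contraT => /(bP j).2 //.
apply: (@ptime_ext _ _ _ zs) => [j [_ b0]|].
  by case: ifP => // /(bP j).1.
by apply: ptime_sub Ps => j [_ b0] /(bP j).1.
Qed.

End Reduction.

Local Open Scope ring_scope.

Theorem theorem6 (R : realType) (l : nat) (c : rat) (l_gt0 : (0 < l)%N)
    (alg : poly_time_algorithm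
       (fun G : wgraph => chordal (@adj G))
       enc_wgraph enc_edge_set
       (fun G => approx_min (maximal_dist_matching R (@adj G) (2 * l)%N)
                            (fun M => ratr (weight M) : R)
                            (ratr c * ln (nverts G)%:R)))
    (d : nat) (d_gt1 : (1 < d)%N) :
  poly_time_algorithm
    (fun I : set_cover_instance =>
       (1 < univ I)%N /\ (size (sets I) <= univ I ^ d)%N)
    enc_set_cover_instance enc_subcollection
    (fun I => approx_min (@is_set_cover I)
                         (fun C => #|C|%:R : R)
                         (ratr c * (d + 1)%:R * ln (univ I)%:R)).
Proof.
have [z [[C [p H]] Hz]] := ptime_approx l_gt0 alg d_gt1.
exists C, p => I DI.
have [t r le] := H (exist _ I DI) Logic.I.
have [o [zo spec]] := Hz (exist _ I DI).
by exists o, t; split=> //; eexists; split; [exact: r | rewrite /st0 update_eq].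
Qed.
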